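(* Let $r\geq 2$, $p\in[1,r-1]$ and $\nu\in[0,r-p]$ be arbitrary integers. (I) If $r=\nu+p$ and $\nu\geq 1$, then $\mathcal{GP}(r,\nu,p)\subset\mathcal{P}$. (II) The set $\mathcal{GP}(r,\nu,p)$ is state-space equivalent to the set of positive functions $\mathcal{GP}(r,r-p,p)$; that is, with $J=\mathrm{diag}\{I_\nu,-I_{r-p-\nu}\}$, the map $L\mapsto \mathrm{diag}\{J,I_p\}\,L$ is a bijection from the set of system matrices $\overline{\mathbb{L}}(\mathrm{diag}\{E_{\nu,r-p},I_p\})$ defining $\mathcal{GP}(r,\nu,p)$ onto the set of system matrices $\overline{\mathbb{L}}(\mathrm{diag}\{-I_{r-p},I_p\})$ defining $\mathcal{GP}(r,r-p,p)$. (III) For given $r>p\geq 1$, the set of $p\times p$-valued rational generalized positive functions whose realization is of dimension $r-p$ can be described as $$\bigcup_{\nu=0}^{r-p}\mathcal{GP}(r,\nu,p).$$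
   Context: $\mathbb{C}_+$ is the open right half plane; $\overline{\mathbb{P}}_k$ is the set of $k\times k$ Hermitian positive semidefinite complex matrices. A $p\times p$-valued rational function $F$ is positive ($F\in\mathcal{P}$) if it is analytic in $\mathbb{C}_+$ and $F(s)+F(s)^*\in\overline{\mathbb{P}}_p$ for all $s\in\mathbb{C}_+$; it is generalized positive ($\mathcal{GP}$) if $F(i\omega)+F(i\omega)^*\in\overline{\mathbb{P}}_p$ for almost every $\omega\in\mathbb{R}$. For a Hermitian nonsingular $r\times r$ matrix $H$, $\overline{\mathbb{L}}(H):=\{L\in\mathbb{C}^{r\times r}: HL+L^*H\in\overline{\mathbb{P}}_r\}$. For integers $0\le\nu\le l$, $E_{\nu,l}:=\mathrm{diag}\{-I_\nu,\,I_{l-\nu}\}$. A realization of dimension $r-p$ of a $p\times p$-valued rational function $\Psi$ is a matrix $L=\begin{pmatrix}A&B\\ C&D\end{pmatrix}\in\mathbb{C}^{r\times r}$ (also called system matrix), with $A$ of size $(r-p)\times(r-p)$ and $D$ of size $p\times p$, such that $\Psi(s)=C(sI_{r-p}-A)^{-1}B+D$; it need not be minimal. $\mathcal{GP}(r,\nu,p)$ is the set of all $p\times p$-valued rational functions that have such a realization with $L\in\overline{\mathbb{L}}(\mathrm{diag}\{E_{\nu,r-p},I_p\})$. *)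

(* Defs.v *)
From HB Require Import structures.
From mathcomp Require Import all_boot all_order all_algebra.
From mathcomp Require Import all_classical all_reals all_analysis.
From mathcomp Require Export complex.

Set Implicit Arguments.
Unset Strict Implicit.
Unset Printing Implicit Defensive.

Import Order.TTheory GRing.Theory Num.Theory.
Import numFieldNormedType.Exports.

Local Open Scope classical_set_scope.
Local Open Scope ring_scope.
Local Open Scope sesquilinear_scope.
Local Open Scope complex_scope.

(* A p x p-valued rational function is a matrix over the field C(s) of
   fractions of C[s]. *)
Notation ratmx R p := ('M[{fraction {poly R[i]}}]_p).

Section RationalFunctions.
Variable R : realType.
Local Notation C := R[i].

(* Value of a rational function at s, computed from a representative in lowest
   terms; as division by 0 yields 0, the value at a pole is 0. *)
Definition rat_eval (f : {fraction {poly C}}) (s : C) : C :=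
  let n := (repr f).1 in
  let d := (repr f).2 in
  (n %/ gcdp n d).[s] / (d %/ gcdp n d).[s].

Lemma fraction_repr (f : {fraction {poly C}}) :
  f = FracField.tofrac (repr f).1 / FracField.tofrac (repr f).2.
Proof.
have d0 : (repr f).2 != 0 by exact: denom_ratioP.
apply: (@mulIf _ (FracField.tofrac (repr f).2)); first by rewrite tofrac_eq0.
rewrite mulfVK ?tofrac_eq0// -{1}[f]reprK.
unlock FracField.tofrac; rewrite -[LHS]FracField.pi_mul.
apply/eqmodP; rewrite /= FracField.equivfE /FracField.mulf.
by rewrite !numden_Ratio ?(oner_neq0, mulr1)// mulrC.
Qed.

(* rat_eval does not depend on the representative: any fraction n / d of
   polynomials is evaluated by evaluating n and d, as soon as d.[s] != 0. *)
Lemma rat_evalE (n d : {poly C}) (s : C) : d.[s] != 0 ->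
  rat_eval (FracField.tofrac n / FracField.tofrac d) s = n.[s] / d.[s].
Proof.
move=> ds0; rewrite /rat_eval; set f := FracField.tofrac n / FracField.tofrac d.
have d0 : d != 0 by apply: contraNneq ds0 => ->; rewrite horner0.
have b0 : (repr f).2 != 0 by exact: denom_ratioP.
set n1 := (repr f).1 in b0 *; set d1 := (repr f).2 in b0 *.
have e1 : n1 * d = n * d1.
  apply/eqP; rewrite -tofrac_eq !tofracM; apply/eqP.
  have := fraction_repr f; rewrite -/n1 -/d1 {1}/f => /eqP.
  by rewrite eqr_div ?tofrac_eq0// => /eqP ->.
have g0 : gcdp n1 d1 != 0 by rewrite gcdp_eq0 negb_and b0 orbT.
have e2 : (n1 %/ gcdp n1 d1) * d = n * (d1 %/ gcdp n1 d1).
  apply: (mulIf g0); rewrite mulrAC divpK ?dvdp_gcdl//.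
  by rewrite -mulrA divpK ?dvdp_gcdr.
have cop : coprimep (d1 %/ gcdp n1 d1) (n1 %/ gcdp n1 d1).
  by rewrite coprimep_sym coprimep_div_gcd// b0 orbT.
have bs0 : (d1 %/ gcdp n1 d1).[s] != 0.
  have : d1 %/ gcdp n1 d1 %| d.
    by rewrite -(Gauss_dvdpr _ cop) e2 dvdp_mull.
  by move=> /dvdpP[q dE]; apply: contraNneq ds0 => b; rewrite dE hornerM b mulr0.
by apply/eqP; rewrite eqr_div//; rewrite -!hornerM e2.
Qed.

Definition ratmx_eval p (F : ratmx R p) (s : C) : 'M[C]_p :=
  map_mx (rat_eval^~ s) F.

(* Complex differentiability at every point of U. It fails at a pole, near
   which the values are unbounded. *)
Definition analytic_in p (F : ratmx R p) (U : set C) : Prop :=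
  forall s, U s -> forall i j,
    derivable (fun z : C^o => ratmx_eval F z i j : C^o) s 1.

Definition right_half_plane : set C := [set s | 0 < complex.Re s].

Definition psd k : set 'M[C]_k :=
  [set M | M \is hermsymmx /\
           forall x : 'cV[C]_k, 0 <= (x ^t* *m M *m x) ord0 ord0].

Definition positive_fun p : set (ratmx R p) :=
  [set F | analytic_in F right_half_plane /\
           forall s, right_half_plane s ->
             psd (ratmx_eval F s + (ratmx_eval F s) ^t* )].

Definition gen_positive_fun p : set (ratmx R p) :=
  [set F | {ae (@lebesgue_measure R), forall w : R,
             psd (ratmx_eval F (0 +i* w) + (ratmx_eval F (0 +i* w)) ^t* )}].

End RationalFunctions.

Section Realizations.
Variable R : realType.
Local Notation C := R[i].

Definition Lbar r (H : 'M[C]_r) : set 'M[C]_r :=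
  [set L | psd (H *m L + L ^t* *m H)].

Definition Emx nu l : 'M[C]_l :=
  diag_mx (\row_(i < l) if (i < nu)%N then -1 else 1).

Definition Jmx nu l : 'M[C]_l :=
  diag_mx (\row_(i < l) if (i < nu)%N then 1 else -1).

Definition diag2 m n (A : 'M[C]_m) (B : 'M[C]_n) : 'M[C]_(m + n) :=
  block_mx A 0 0 B.

(* The r x r system matrices are typed with r written as (r - p) + p, which is
   r whenever p <= r; this gives access to their blocks. *)
Notation sysmx r p := 'M[C]_((r - p) + p).

Definition const_ratmx m n : 'M[C]_(m, n) -> 'M[{fraction {poly C}}]_(m, n) :=
  map_mx (fun c => FracField.tofrac c%:P).

(* C (s I - A)^-1 B + D as an identity over C(s), where s I - A is invertible;
   char_poly_mx A is 'X%:M - A. *)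
Definition transfer m p (L : 'M[C]_(m + p)) : ratmx R p :=
  const_ratmx (dlsubmx L)
    *m invmx (map_mx (@FracField.tofrac _) (char_poly_mx (ulsubmx L)))
    *m const_ratmx (ursubmx L)
  + const_ratmx (drsubmx L).

Definition sys_weight r nu p : sysmx r p := diag2 (Emx nu (r - p)) 1%:M.

Definition GP r nu p : set (ratmx R p) :=
  [set Psi | exists2 L : sysmx r p,
               Lbar (sys_weight r nu p) L & Psi = transfer L].

Lemma sys_weight_herm r nu p : sys_weight r nu p \is hermsymmx.
Proof.
rewrite qualifE /= expr0 scale1r /sys_weight /diag2 tr_block_mx map_block_mx.
rewrite !trmx0 !map_mx0 /Emx tr_diag_mx trmx1 map_mx1; apply/eqP; congr block_mx.
rewrite map_diag_mx; congr diag_mx; apply/rowP => i; rewrite !mxE.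
by case: ifP => _; rewrite ?rmorphN rmorph1.
Qed.

Lemma sys_weight_unit r nu p : sys_weight r nu p \in unitmx.
Proof.
rewrite unitmxE /sys_weight /diag2 det_ublock det1 mulr1 det_diag.
apply/unitr_prod => /= i _; rewrite mxE.
by case: ifP => _; rewrite ?unitrN unitr1.
Qed.

Lemma char_poly_mx_unit n (A : 'M[C]_n) :
  map_mx (@FracField.tofrac _) (char_poly_mx A) \in unitmx.
Proof.
rewrite unitmxE unitfE det_map_mx tofrac_eq0.
by rewrite monic_neq0// char_poly_monic.
Qed.

End Realizations.

Notation sysmx R r p := ('M[R[i]]_((r - p) + p)).
Arguments Lbar {R r} H.
Arguments Emx R nu l : clear implicits.
Arguments Jmx R nu l : clear implicits.
Arguments positive_fun R p : clear implicits.
Arguments gen_positive_fun R p : clear implicits.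
Arguments GP R r nu p : clear implicits.

(* Main.v *)
(** The heart of the matter is part (III): a generalized positive function with a
    given realization (A, B, C, D) has a realization of the same dimension whose
    system matrix satisfies the Lyapunov-type inequality for some signature
    matrix E.

    Discretize s x = A x + B w by the midpoint rule
    a (x' - x) = A (x' + x) + B w with supply 2 Re w^*(C (x' + x) + D w); the
    rule corresponds to s = a (z - 1) / (z + 1), which maps |z| = 1 to the
    imaginary axis. Positivity on the imaginary axis and a finite Parseval
    identity show that trajectories from 0 to 0 receive nonnegative supply. Hence
    the minimal supply needed to reach x from 0 in N steps is a Hermitian form
    in x, nonincreasing in N and bounded below, and its limit V satisfies
    V(x') <= V(x) + supply. The midpoint rule turns this into the
    continuous-time inequality with H = - V / (2 a), on the reachable space.
    Composing with a projection onto the reachable space and then killing the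
    (unobservable) kernel of H, neither of which changes the transfer function
    or the dimension, gives an invertible H, congruent to some E. *)

Require Import Defs.
From HB Require Import structures.
From mathcomp Require Import all_boot all_order all_algebra.
From mathcomp Require Import all_fingroup.
From mathcomp Require Import all_classical all_reals all_analysis.
From mathcomp Require Import complex.
From mathcomp Require Import ring lra cyclic separable cyclotomic.

Set Implicit Arguments.
Unset Strict Implicit.
Unset Printing Implicit Defensive.

Import Order.TTheory GRing.Theory Num.Theory.
Import numFieldNormedType.Exports.

Local Open Scope classical_set_scope.
Local Open Scope ring_scope.
Local Open Scope sesquilinear_scope.

(** * Hermitian forms and fiberwise minimizers *)

Section HermitianForms.
Variable C : numClosedFieldType.
Implicit Types (m n k : nat).

Definition dotc n (x y : 'cV[C]_n) : C := (x ^t* *m y) ord0 ord0.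

Lemma dotcDl n (x y z : 'cV[C]_n) : dotc (x + y) z = dotc x z + dotc y z.
Proof. by rewrite /dotc linearD /= map_mxD mulmxDl mxE. Qed.

Lemma dotcDr n (x y z : 'cV[C]_n) : dotc x (y + z) = dotc x y + dotc x z.
Proof. by rewrite /dotc mulmxDr mxE. Qed.

Lemma dotcZl n a (x y : 'cV[C]_n) : dotc (a *: x) y = a^* * dotc x y.
Proof. by rewrite /dotc linearZ /= map_mxZ -scalemxAl mxE. Qed.

Lemma dotcZr n a (x y : 'cV[C]_n) : dotc x (a *: y) = a * dotc x y.
Proof. by rewrite /dotc -scalemxAr mxE. Qed.

Lemma dotcNr n (x y : 'cV[C]_n) : dotc x (- y) = - dotc x y.
Proof. by rewrite -scaleN1r dotcZr mulN1r. Qed.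

Lemma dotc0l n (y : 'cV[C]_n) : dotc 0 y = 0.
Proof. by rewrite -(scale0r y) dotcZl rmorph0 mul0r. Qed.

Lemma dotc0r n (y : 'cV[C]_n) : dotc y 0 = 0.
Proof. by rewrite -(scale0r y) dotcZr mul0r. Qed.

Lemma dotc_suml n (I : Type) (s : seq I) (F : I -> 'cV[C]_n) y :
  dotc (\sum_(i <- s) F i) y = \sum_(i <- s) dotc (F i) y.
Proof. by elim/big_rec2: _ => [|i a b _ <-]; rewrite ?dotc0l ?dotcDl. Qed.

Lemma dotc_sumr n (I : Type) (s : seq I) (F : I -> 'cV[C]_n) y :
  dotc y (\sum_(i <- s) F i) = \sum_(i <- s) dotc y (F i).
Proof. by elim/big_rec2: _ => [|i a b _ <-]; rewrite ?dotc0r ?dotcDr. Qed.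

Lemma dotcE n (x y : 'cV[C]_n) : dotc x y = \sum_i (x i ord0)^* * y i ord0.
Proof. by rewrite /dotc mxE; apply: eq_bigr => i _; rewrite !mxE. Qed.

Lemma conj_dotc n (x y : 'cV[C]_n) : (dotc x y)^* = dotc y x.
Proof.
rewrite !dotcE rmorph_sum; apply: eq_bigr => i _.
by rewrite rmorphM /= conjCK mulrC.
Qed.

Lemma dotc_adj m n (A : 'M[C]_(m, n)) x y : dotc x (A *m y) = dotc (A ^t* *m x) y.
Proof. by rewrite /dotc trmx_mul map_mxM /= trmxCK mulmxA. Qed.

Lemma dotc_ge0 n (x : 'cV[C]_n) : 0 <= dotc x x.
Proof. by rewrite dotcE sumr_ge0// => i _; rewrite mulrC mul_conjC_ge0. Qed.

Lemma dotc_eq0 n (x : 'cV[C]_n) : (dotc x x == 0) = (x == 0).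
Proof.
apply/idP/eqP => [|->]; last by rewrite dotc0r.
rewrite dotcE psumr_eq0 => [/allP h|i _]; last by rewrite mulrC mul_conjC_ge0.
apply/colP => i; have := h i; rewrite mem_index_enum => /(_ isT).
by rewrite mulrC mul_conjC_eq0 mxE => /eqP.
Qed.

Lemma dotc_col_mx m n (x z : 'cV[C]_m) (y t : 'cV[C]_n) :
  dotc (col_mx x y) (col_mx z t) = dotc x z + dotc y t.
Proof. by rewrite /dotc tr_col_mx map_row_mx mul_row_col mxE. Qed.

Definition qform n (M : 'M[C]_n) x := dotc x (M *m x).

Lemma qformE n (M : 'M[C]_n) x : qform M x = (x ^t* *m M *m x) ord0 ord0.
Proof. by rewrite /qform /dotc mulmxA. Qed.

Lemma hermsymmxE n (M : 'M[C]_n) : (M \is hermsymmx) = (M ^t* == M).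
Proof. by rewrite qualifE /= expr0 scale1r eq_sym. Qed.

Lemma herm_dotc n (M : 'M[C]_n) x y : M \is hermsymmx ->
  dotc x (M *m y) = dotc (M *m x) y.
Proof. by rewrite hermsymmxE => /eqP MM; rewrite dotc_adj MM. Qed.

Lemma herm_conj n (M : 'M[C]_n) x y : M \is hermsymmx ->
  (dotc x (M *m y))^* = dotc y (M *m x).
Proof. by move=> hM; rewrite conj_dotc herm_dotc. Qed.

Lemma qform_real n (M : 'M[C]_n) x : M \is hermsymmx -> qform M x \is Num.real.
Proof. by move=> hM; rewrite CrealE /qform herm_conj. Qed.

Lemma qformD n (M : 'M[C]_n) x y : M \is hermsymmx ->
  qform M (x + y) = qform M x + qform M y + (dotc x (M *m y) + (dotc x (M *m y))^*).
Proof.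
move=> hM; rewrite herm_conj// /qform mulmxDr !dotcDr !dotcDl.
by ring.
Qed.

Lemma qformZ n (M : 'M[C]_n) a x : qform M (a *: x) = a^* * a * qform M x.
Proof. by rewrite /qform -scalemxAr dotcZl dotcZr mulrA. Qed.

Lemma qform_mul m n (M : 'M[C]_n) (T : 'M[C]_(n, m)) x :
  qform (T ^t* *m M *m T) x = qform M (T *m x).
Proof. by rewrite /qform -!mulmxA dotc_adj trmxCK. Qed.

Lemma herm_mul m n (M : 'M[C]_n) (T : 'M[C]_(n, m)) :
  M \is hermsymmx -> T ^t* *m M *m T \is hermsymmx.
Proof.
rewrite !hermsymmxE => /eqP hM.
by rewrite !trmx_mul !map_mxM /= hM trmxCK mulmxA.
Qed.

Lemma herm_add n (M N : 'M[C]_n) :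
  M \is hermsymmx -> N \is hermsymmx -> M + N \is hermsymmx.
Proof.
by rewrite !hermsymmxE => /eqP hM /eqP hN; rewrite linearD /= map_mxD hM hN.
Qed.

Lemma herm_scale n a (M : 'M[C]_n) :
  a \is Num.real -> M \is hermsymmx -> a *: M \is hermsymmx.
Proof.
rewrite !hermsymmxE CrealE => /eqP ha /eqP hM.
by rewrite linearZ /= map_mxZ /= hM ha.
Qed.

Lemma herm_addT n (M : 'M[C]_n) : M + M ^t* \is hermsymmx.
Proof. by rewrite hermsymmxE linearD /= map_mxD trmxCK addrC. Qed.

(** Along [y + t *: x] the quadratic term vanishes, so the form is affine in [t] over the reals and
    is bounded below only if its linear part is zero. *)
Lemma isotropic_dotc_eq0 n (M : 'M[C]_n) (x y : 'cV[C]_n) : M \is hermsymmx ->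
  qform M x = 0 -> (exists b, forall t, b <= qform M (y + t *: x)) ->
  dotc x (M *m y) = 0.
Proof.
move=> hM x0 [b hb]; apply/eqP; apply/negPn/negP => d0.
set d := dotc x (M *m y) in d0.
have dd : 0 < d^* * d by rewrite lt_neqAle mulrC mul_conjC_ge0 eq_sym mul_conjC_eq0 d0.
have br : b - qform M y <= 0 by have := hb 0; rewrite scale0r addr0 subr_le0.
(* Makes the form equal to [b - 1] at [t = e * d], below the bound. *)
pose e := (b - qform M y - 1) / (2 * (d^* * d)).
have er : e^* = e.
  apply/eqP; rewrite -CrealE; apply: rpred_div.
    by apply: rpredB; rewrite ?rpred1 ?ler0_real.
  by rewrite rpredM ?realn// gtr0_real.
have := hb (e * d).
rewrite qformD// qformZ x0 mulr0 addr0 herm_conj// -scalemxAr dotcZr dotcZl -/d.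
rewrite -[dotc y (M *m x)]herm_conj// -/d rmorphM /= er.
have -> : e * d * d^* + e * d^* * d = e * (2 * (d^* * d)) by ring.
rewrite divfK; last by rewrite mulf_neq0 ?pnatr_eq0// gt_eqF.
have -> : qform M y + (b - qform M y - 1) = b - 1 by ring.
by rewrite -subr_ge0 addrAC subrr sub0r oppr_ge0 ler10.
Qed.

(** Completing the square: a point w minimizes on its fiber of [Q] once M w is orthogonal to the
    kernel of [Q]. Boundedness below makes this linear condition solvable, so the minimizer can be
    chosen linear in the parameter. *)
Lemma fiberwise_minimizer m n (M : 'M[C]_m) (Q : 'M[C]_(n, m)) :
    M \is hermsymmx ->
    (forall v, Q *m v = 0 -> 0 <= qform M v) ->
    (forall w, exists b, forall v, Q *m v = 0 -> b <= qform M (w + v)) ->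
  exists T : 'M[C]_(m, n), Q *m T *m Q = Q /\
    forall y w, Q *m w = Q *m (T *m y) -> qform M (T *m y) <= qform M w.
Proof.
move=> hM ker_ge0 fib.
(* [kermx] acts on rows; after transposition the columns of [K] span the kernel of [Q]. *)
pose K : 'M[C]_m := (kermx Q^T)^T.
have QK : Q *m K = 0 by rewrite -[Q]trmxK -trmx_mul mulmx_ker trmx0.
have kerK v : Q *m v = 0 -> exists v0 : 'cV_m, v = K *m v0.
  move=> Qv; have : (v^T <= kermx Q^T)%MS.
    by apply/sub_kermxP; rewrite -trmx_mul Qv trmx0.
  by case/submxP => D vD; exists D^T; rewrite -trmx_mul -vD trmxK.
pose N := K ^t* *m M *m K.
have hN : N ^t* = N by apply/eqP; rewrite -hermsymmxE herm_mul.
(* If N v = 0 then K v is isotropic, hence orthogonal to every M y: the kernel of [N] lies in that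
   of [M *m K]. *)
have MKN : (M *m K <= N)%MS.
  rewrite submxE; apply/eqP/matrixP => i j; rewrite [RHS]mxE.
  have: M *m (K *m col j (cokermx N)) = 0.
    set v := col j _.
    have Nv : N *m v = 0 by rewrite /v colE mulmxA mulmx_coker mul0mx.
    have fv : qform M (K *m v) = 0 by rewrite -qform_mul -/N /qform Nv dotc0r.
    have dv y : dotc (K *m v) (M *m y) = 0.
      apply: isotropic_dotc_eq0 => //; have [b hb] := fib y; exists b => t.
      by apply: hb; rewrite -scalemxAr mulmxA QK mul0mx scaler0.
    by apply/eqP; rewrite -dotc_eq0 -(herm_dotc _ _ hM) dv.
  by move=> /colP/(_ i); rewrite colE !mulmxA -colE !mxE.
have [D MKD] := submxP MKN.
have NZ : N *m D ^t* = K ^t* *m M.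
  move: hM; rewrite hermsymmxE => /eqP <-.
  by rewrite -{1}hN -!map_mxM -!trmx_mul MKD.
pose S := pinvmx Q; have QSQ : Q *m S *m Q = Q by rewrite mulmxKpV.
(* The generalized inverse [S], corrected inside the kernel of [Q] so that K^* M T = 0. *)
pose T := S - K *m (D ^t* *m S).
have QT : Q *m T = Q *m S by rewrite mulmxBr (mulmxA Q K) QK mul0mx subr0.
exists T; split=> [|y w Qw]; first by rewrite QT.
have -> : w = T *m y + (w - T *m y) by rewrite addrC subrK.
have [|v0 ->] := kerK (w - T *m y); first by rewrite mulmxBr Qw subrr.
rewrite qformD// -[dotc (T *m y) (M *m (K *m v0))]herm_conj//.
have -> : dotc (K *m v0) (M *m (T *m y)) = 0.
  rewrite -[K]trmxCK -dotc_adj !mulmxA mulmxBr !mulmxA -/N -(mulmxA N).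
  by rewrite mulmxA NZ subrr mul0mx dotc0r.
rewrite !rmorph0 !addr0 lerDl ker_ge0// mulmxA QK mul0mx //.
Qed.

End HermitianForms.

(** * Minimal costs of a discrete-time system *)

Section ColumnSpaces.
Variable F : fieldType.

Lemma colspan_factor n m k (Q : 'M[F]_(n, m)) (P : 'M[F]_(n, k)) :
  (forall y : 'cV_m, exists z : 'cV_k, Q *m y = P *m z) -> exists Z, Q = P *m Z.
Proof.
move=> h; have /submxP[D QD] : (Q^T <= P^T)%MS.
  apply/row_subP => i; have [z Qz] := h (delta_mx i 0).
  by rewrite -tr_col colE Qz trmx_mul submxMl.
by exists D^T; rewrite -[LHS]trmxK QD trmx_mul trmxK.
Qed.

Lemma colspan_rank_factor n m k (Q : 'M[F]_(n, m)) (P : 'M[F]_(n, k)) Z :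
  Q = P *m Z -> (\rank P <= \rank Q)%N -> exists Z', P = Q *m Z'.
Proof.
move=> QPZ; rewrite -mxrank_tr -[X in (_ <= X)%N]mxrank_tr => rk.
have QP : (Q^T <= P^T)%MS by rewrite QPZ trmx_mul submxMl.
have /submxP[D PD] : (P^T <= Q^T)%MS.
  by rewrite -(mxrank_leqif_sup QP) eqn_leq rk mxrankS.
by exists D^T; rewrite -[LHS]trmxK PD trmx_mul trmxK.
Qed.

End ColumnSpaces.

Section DiscreteSystem.
Variables (C : numClosedFieldType) (n p : nat).
Variables (A : 'M[C]_n) (B : 'M[C]_(n, p)).
Implicit Types (Sg : 'M[C]_(n + p)) (us : seq 'cV[C]_p) (x : 'cV[C]_n).

Definition traj x us : 'cV[C]_n := foldl (fun x w => A *m x + B *m w) x us.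

Fixpoint cost Sg x us : C :=
  if us is w :: us' then qform Sg (col_mx x w) + cost Sg (A *m x + B *m w) us'
  else 0.

Lemma traj_cat x us us' : traj x (us ++ us') = traj (traj x us) us'.
Proof. exact: foldl_cat. Qed.

Lemma traj_rcons x us w : traj x (rcons us w) = A *m traj x us + B *m w.
Proof. by rewrite -cats1 traj_cat. Qed.

Lemma cost_cat Sg x us us' :
  cost Sg x (us ++ us') = cost Sg x us + cost Sg (traj x us) us'.
Proof. by elim: us x => [|w us IH] x /=; rewrite ?add0r// IH addrA. Qed.

Lemma cost_rcons Sg x us w :
  cost Sg x (rcons us w) = cost Sg x us + qform Sg (col_mx (traj x us) w).
Proof. by rewrite -cats1 cost_cat /= addr0. Qed.

Lemma cost0 x us : cost 0 x us = 0.
Proof. by elim: us x => //= w us IH x; rewrite IH /qform mul0mx dotc0r addr0. Qed.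

Lemma traj_nseq0 N us : traj 0 (nseq N 0 ++ us) = traj 0 us.
Proof. by elim: N => //= N IH; rewrite !mulmx0 addr0. Qed.

(** Superposition of the free response of [x] and the forced response from 0. *)
Lemma traj_shift x us : traj x us = traj x (nseq (size us) 0) + traj 0 us.
Proof.
have nseq_rcons k : nseq k.+1 (0 : 'cV[C]_p) = rcons (nseq k 0) 0.
  by elim: k => //= k <-.
elim/last_ind: us => [|us w IH]; first by rewrite /= addr0.
rewrite size_rcons nseq_rcons !traj_rcons IH mulmxDr mulmx0 addr0.
by rewrite addrA.
Qed.

Definition reach N x := exists2 us, size us = N & traj 0 us = x.

Lemma reach_leq N N' x : (N <= N')%N -> reach N x -> reach N' x.
Proof.
move=> NN' [us sz <-]; exists (nseq (N' - N) 0 ++ us); last exact: traj_nseq0.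
by rewrite size_cat size_nseq sz subnK.
Qed.

(* [P] is the minimal cost of reaching [Q *m y] from 0 in [N] steps: minimizing
   over the last step and the parameter of the previous state at once keeps the
   induction within matrices of fixed size. *)
Lemma min_cost_qform Sg : Sg \is hermsymmx ->
    (forall us, traj 0 us = 0 -> 0 <= cost Sg 0 us) ->
    (forall x, exists b, forall us, traj 0 us = x -> b <= cost Sg 0 us) ->
  forall N, exists Q P : 'M[C]_n, [/\ P \is hermsymmx,
    forall y, exists us,
      [/\ size us = N, traj 0 us = Q *m y & cost Sg 0 us = qform P y],
    forall us, size us = N -> exists y, traj 0 us = Q *m y &
    forall us y, size us = N -> traj 0 us = Q *m y -> qform P y <= cost Sg 0 us].
Proof.
move=> hSg loops bounded; elim=> [|N [Q [P [hP attained span minimal]]]].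
  exists 0, 0; split=> [|y|us /size0nil ->|us y /size0nil -> _].
  - by rewrite hermsymmxE trmx0 map_mx0.
  - by exists [::]; rewrite /qform !mul0mx dotc0r.
  - by exists 0; rewrite mul0mx.
  - by rewrite /qform mul0mx dotc0r.
(* On a pair (y, w), [M] is the minimal cost of reaching [Q *m y] in [N] steps plus that of then
   applying [w], and [L] gives the resulting state. *)
pose E : 'M[C]_(n + p) := block_mx Q 0 0 1%:M.
pose M : 'M[C]_(n + p) := block_mx P 0 0 0 + E ^t* *m Sg *m E.
pose L : 'M[C]_(n, n + p) := row_mx (A *m Q) B.
have LE y w : L *m col_mx y w = A *m (Q *m y) + B *m w.
  by rewrite mul_row_col mulmxA.
have ME y w : qform M (col_mx y w) = qform P y + qform Sg (col_mx (Q *m y) w).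
  rewrite /qform mulmxDl dotcDr; congr (_ + _).
    by rewrite mul_block_col !mul0mx !addr0 dotc_col_mx dotc0r addr0.
  rewrite -!/(qform _ _) qform_mul mul_block_col !mul0mx.
  by rewrite addr0 add0r mul1mx.
have hM : M \is hermsymmx.
  rewrite herm_add ?herm_mul// hermsymmxE tr_block_mx map_block_mx !trmx0 !map_mx0.
  by move: hP; rewrite hermsymmxE => /eqP ->.
have att v : exists us,
    [/\ size us = N.+1, traj 0 us = L *m v & cost Sg 0 us = qform M v].
  rewrite -[v]vsubmxK; have [us [sz tr co]] := attained (usubmx v).
  exists (rcons us (dsubmx v)).
  by rewrite size_rcons sz traj_rcons cost_rcons tr co LE ME.
have [|w|T [LTL minT]] := fiberwise_minimizer hM (Q := L).
- by move=> v Lv; have [us [_ + <-]] := att v; rewrite Lv => /loops.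
- have [b hb] := bounded (L *m w); exists b => v Lv.
  have [us [_ tr <-]] := att (w + v); apply: hb.
  by rewrite tr mulmxDr Lv addr0.
exists (L *m T), (T ^t* *m M *m T); split=> [|y|us|us y].
- exact: herm_mul.
- by have [us] := att (T *m y); rewrite qform_mul mulmxA; exists us.
- case/lastP: us => // us w; rewrite size_rcons => -[/span[y tr]].
  by exists (L *m col_mx y w); rewrite mulmxA LTL LE traj_rcons tr.
- case/lastP: us => // us w; rewrite size_rcons => -[sz].
  have [z tr] := span us sz; rewrite traj_rcons tr -LE -mulmxA => /minT.
  rewrite qform_mul => /le_trans; apply.
  by rewrite ME cost_rcons tr lerD2r minimal.
Qed.

(** The reachable spaces increase with the number of steps and have rank at most [n], so one of
    maximal rank contains every reachable state. *)
Lemma reachable_projection : exists N0 (Q : 'M[C]_n), [/\ Q *m Q = Q,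
  forall y, reach N0 (Q *m y) & forall us, Q *m traj 0 us = traj 0 us].
Proof.
have herm0 : (0 : 'M[C]_(n + p)) \is hermsymmx by rewrite hermsymmxE trmx0 map_mx0.
have span N : exists Q : 'M[C]_n, (forall y, reach N (Q *m y)) /\
    forall us, size us = N -> exists y, traj 0 us = Q *m y.
  (* With zero cost, what remains is a linear parametrization of the states reached in exactly [N]
     steps. *)
  have [us _|x|Q [P [_ att sp _]]] := min_cost_qform herm0 _ _ N.
  - by rewrite cost0.
  - by exists 0 => us _; rewrite cost0.
  exists Q; split=> // y; have [us [? ? _]] := att y; by exists us.
have [Q hQ] := choice span.
pose ranks := [pred k | `[< exists N, \rank (Q N) = k >]].
have [|k|_ /asboolP[N0 <-] maxrk] := @ex_maxnP ranks n.
- by exists (\rank (Q 0%N)); apply/asboolP; exists 0%N.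
- by move=> /asboolP[N <-]; exact: rank_leq_row.
have [I QQ] : exists I, Q N0 *m I *m Q N0 = Q N0.
  by exists (pinvmx (Q N0)); rewrite mulmxKpV.
have incl N : (N0 <= N)%N -> exists Z, Q N = Q N0 *m Z.
  move=> NN; have [Z QZ] : exists Z, Q N0 = Q N *m Z.
    apply: colspan_factor => y.
    have [us sz <-] := reach_leq NN ((hQ N0).1 y).
    exact: (hQ N).2.
  by apply: (colspan_rank_factor QZ); apply: maxrk; apply/asboolP; exists N.
exists N0, (Q N0 *m I); split=> [|y|us].
- by rewrite mulmxA QQ.
- by rewrite -mulmxA; exact: (hQ N0).1.
- pose N := maxn N0 (size us).
  have [Z QZ] := incl N (leq_maxl _ _).
  have [us' sz <-] : reach N (traj 0 us).
    by apply: (reach_leq (leq_maxr _ _)); exists us.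
  have [y ->] := (hQ N).2 us' sz.
  by rewrite QZ !mulmxA QQ.
Qed.

(** [S k] is the minimal cost over [N0 + k] steps: from [N0] steps on every reachable state is
    attained, so all these costs share the parametrization by [Q]. *)
Lemma value_sequence Sg : Sg \is hermsymmx ->
    (forall us, traj 0 us = 0 -> 0 <= cost Sg 0 us) ->
  exists (Q : 'M[C]_n) (S : nat -> 'M[C]_n),
    [/\ Q *m Q = Q, forall y, exists us, traj 0 us = Q *m y &
        forall us, Q *m traj 0 us = traj 0 us] /\
    [/\ forall k, S k \is hermsymmx, forall k y, qform (S k.+1) y <= qform (S k) y,
        forall y, exists b, forall k, b <= qform (S k) y &
        forall k x w, Q *m x = x ->
          qform (S k.+1) (A *m x + B *m w) <= qform (S k) x + qform Sg (col_mx x w)].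
Proof.
move=> hSg loops; have [N0 [Q [QQ reachQ Qtraj]]] := reachable_projection.
(* All inputs leading to [x] are continued by one fixed return to 0; loops cost at least 0, so minus
   the cost of the return is a lower bound. *)
have bounded x : exists b, forall us, traj 0 us = x -> b <= cost Sg 0 us.
  have [[us0 us0x]|nx] := pselect (exists us, traj 0 us = x); last first.
    by exists 0 => us usx; case: nx; exists us.
  have Qx : Q *m traj x (nseq N0 0) = traj x (nseq N0 0).
    by rewrite -us0x -traj_cat Qtraj.
  (* The forced response to [us'] cancels the free evolution of [x] over [N0] steps. *)
  have [us' sz] := reachQ (- traj x (nseq N0 0)).
  rewrite mulmxN Qx => us'x; exists (- cost Sg x us') => us usx.
  rewrite -subr_ge0 opprK -[in cost Sg x us']usx -cost_cat; apply: loops.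
  by rewrite traj_cat usx traj_shift sz us'x subrr.
have step k := min_cost_qform hSg loops bounded (N0 + k).
have {step} /choice[P hP] : forall k, exists P : 'M[C]_n, [/\ P \is hermsymmx,
    forall x, exists us,
      [/\ size us = (N0 + k)%N, traj 0 us = Q *m x & cost Sg 0 us = qform P x] &
    forall us x, size us = (N0 + k)%N -> traj 0 us = Q *m x ->
      qform P x <= cost Sg 0 us].
  move=> k; have [Qk [Pk [hPk att span minimal]]] := step k.
  have [Z QZ] : exists Z, Q = Qk *m Z.
    apply: colspan_factor => y.
    have [us sz <-] := reach_leq (leq_addr k N0) (reachQ y).
    exact: span.
  have [I QI] : exists I, Qk *m I *m Qk = Qk.
    by exists (pinvmx Qk); rewrite mulmxKpV.
  pose G := I *m Q.
  have QG x : Qk *m (G *m x) = Q *m x by rewrite /G QZ !mulmxA QI.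
  exists (G ^t* *m Pk *m G); split=> [|x|us x sz tr].
  - exact: herm_mul.
  - by have [us] := att (G *m x); rewrite QG qform_mul; exists us.
  - by rewrite qform_mul; apply: minimal => //; rewrite QG.
exists Q, P; split; first split=> // [y].
  by have [us _ <-] := reachQ y; exists us.
split=> [k|k y|y|k x w Qx].
- by have [] := hP k.
- have [_ /(_ y)[us [sz tr <-]] _] := hP k; have [_ _ minimal] := hP k.+1.
  (* An idle first step at 0 is free, so one more step cannot raise the minimum. *)
  have := minimal (0 :: us) y; rewrite /= !mulmx0 addr0 sz addnS => /(_ erefl tr).
  by move=> /le_trans; apply; rewrite /qform col_mx0 mulmx0 dotc0r add0r.
- have [b hb] := bounded (Q *m y); exists b => k.
  by have [_ /(_ y)[us [_ tr <-]] _] := hP k; exact: hb.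
- have [_ /(_ x)[us [sz tr <-]] _] := hP k; have [_ _ minimal] := hP k.+1.
  (* An optimal input for [x] followed by [w] is a competitor for the next state. *)
  have := minimal (rcons us w); rewrite size_rcons sz addnS traj_rcons cost_rcons.
  rewrite tr Qx; apply=> //.
  by rewrite -{1 2}Qx -tr -traj_rcons Qtraj.
Qed.

End DiscreteSystem.

(** * Monotone limits of Hermitian forms *)

Section ComplexLimits.
Variable R : realType.
Local Notation C := R[i].
Implicit Types (u v : nat -> C) (a l m : C).

Lemma cReD a l : complex.Re (a + l) = complex.Re a + complex.Re l.
Proof. by case: a; case: l. Qed.

Lemma cImD a l : complex.Im (a + l) = complex.Im a + complex.Im l.
Proof. by case: a; case: l. Qed.

Lemma cReM a l : complex.Re (a * l) =
  complex.Re a * complex.Re l - complex.Im a * complex.Im l.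
Proof. by case: a; case: l. Qed.

Lemma cImM a l : complex.Im (a * l) =
  complex.Re a * complex.Im l + complex.Im a * complex.Re l.
Proof. by case: a; case: l. Qed.

Lemma Re_conjC a : complex.Re a^* = complex.Re a.
Proof. by case: a. Qed.

Lemma Im_conjC a : complex.Im a^* = - complex.Im a.
Proof. by case: a. Qed.

Lemma ler_Re a l : a <= l -> complex.Re a <= complex.Re l.
Proof. by rewrite lecE => /andP[]. Qed.

Lemma ImR0 a : a \is Num.real -> complex.Im a = 0.
Proof.
rewrite CrealE => /eqP/(congr1 (@complex.Im _)); rewrite Im_conjC => h.
by apply/eqP; rewrite -eqNr h.
Qed.

(** Convergence by real and imaginary parts reduces limits to real sequences, where monotone
    convergence applies. *)
Definition ccvg u l := (fun k => complex.Re (u k)) @ \oo --> complex.Re l /\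
  (fun k => complex.Im (u k)) @ \oo --> complex.Im l.

Lemma ccvgD u v l m : ccvg u l -> ccvg v m -> ccvg (fun k => u k + v k) (l + m).
Proof.
move=> [ul1 ul2] [vm1 vm2]; split.
  by rewrite cReD; under eq_fun do rewrite /= cReD; exact: cvgD.
by rewrite cImD; under eq_fun do rewrite /= cImD; exact: cvgD.
Qed.

Lemma ccvgMr a u l : ccvg u l -> ccvg (fun k => a * u k) (a * l).
Proof.
move=> [ul1 ul2]; split.
  rewrite cReM; under eq_fun do rewrite /= cReM.
  by apply: cvgB; exact: cvgMr.
rewrite cImM; under eq_fun do rewrite /= cImM.
by apply: cvgD; exact: cvgMr.
Qed.

Lemma ccvg_sum (I : Type) (s : seq I) (F : I -> nat -> C) (l : I -> C) :
  (forall i, ccvg (F i) (l i)) ->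
  ccvg (fun k => \sum_(i <- s) F i k) (\sum_(i <- s) l i).
Proof.
move=> Fl; elim: s => [|i s IH].
  by rewrite big_nil; under eq_fun do rewrite big_nil; split; exact: cvg_cst.
by rewrite big_cons; under eq_fun do rewrite big_cons; exact: ccvgD.
Qed.

Lemma ccvg_unique u l m : ccvg u l -> ccvg u m -> l = m.
Proof.
move=> [l1 l2] [m1 m2]; apply/eqP; rewrite eq_complex.
by rewrite (cvg_unique _ l1 m1) ?(cvg_unique _ l2 m2) ?eqxx//; exact: Rhausdorff.
Qed.

Lemma ccvg_conj u l : ccvg u l -> ccvg (fun k => (u k)^*) l^*.
Proof.
move=> [l1 l2]; split; first by rewrite Re_conjC; under eq_fun do rewrite /= Re_conjC.
by rewrite Im_conjC; under eq_fun do rewrite /= Im_conjC; exact: cvgN.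
Qed.

(** Monotone convergence gives the limits of the quadratic values, and polarization those of the
    matrix entries. *)
Lemma herm_monotone_limit n (S : nat -> 'M[C]_n) :
    (forall k, S k \is hermsymmx) ->
    (forall k y, qform (S k.+1) y <= qform (S k) y) ->
    (forall y, exists b, forall k, b <= qform (S k) y) ->
  exists H : 'M[C]_n, [/\ H \is hermsymmx, forall k y, qform H y <= qform (S k) y &
    forall y a, (forall k, a <= qform (S k) y) -> a <= qform H y].
Proof.
move=> hS decS bndS.
pose v k y := complex.Re (qform (S k) y).
have dec y : {homo v^~ y : n m / (n <= m)%N >-> m <= n}.
  by apply/nonincreasing_seqP => k; apply: ler_Re.
have cv y : cvgn (v^~ y).
  apply: nonincreasing_is_cvgn => //; have [b hb] := bndS y.
  by exists (complex.Re b) => _ [k _ <-]; apply: ler_Re.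
have cvRe x y : cvgn (fun k => complex.Re (dotc x (S k *m y))).
  (* Polarization of real parts: [t] and [u] stand for the values at [x] and [y], [d] for the cross
     term. *)
  have polar (t u d : R) : d = 4^-1 * (t + u + (d + d) - (t + u + (- d - d))).
    by field.
  have -> : (fun k => complex.Re (dotc x (S k *m y))) =
            (fun k => 4^-1 * (v k (x + y) - v k (x - y))).
    apply/funext => k; rewrite /v !(qformD _ _ (hS k)).
    rewrite !cReD !Re_conjC.
    rewrite -[- y]scaleN1r qformZ -scalemxAr dotcZr rmorphN1 mulrNN !mul1r mulN1r.
    have ReN (z : C) : complex.Re (- z) = - complex.Re z by case: z.
    by rewrite ReN; exact: polar.
  by apply: is_cvgMr; apply: is_cvgB.
have cvIm x y : cvgn (fun k => complex.Im (dotc x (S k *m y))).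
  have -> : (fun k => complex.Im (dotc x (S k *m y))) =
            (fun k => complex.Re (dotc x (S k *m (- 'i%C *: y)))).
    apply/funext => k; rewrite -scalemxAr dotcZr cReM /=.
    by ring.
  exact: cvRe.
have Sij k i j : dotc (delta_mx i 0) (S k *m delta_mx j 0) = S k i j.
  rewrite -colE dotcE (bigD1 i)//= big1 ?addr0 => [|h hi].
    by rewrite !mxE !eqxx rmorph1 mul1r.
  by rewrite !mxE (negPf hi) rmorph0 mul0r.
pose H : 'M[C]_n := \matrix_(i, j)
  (limn (fun k => complex.Re (S k i j)) +i* limn (fun k => complex.Im (S k i j)))%C.
have SH i j : ccvg (fun k => S k i j) (H i j).
  split; rewrite mxE /=.
    by under [X in cvgn X]eq_fun do rewrite -Sij; exact: cvRe.
  by under [X in cvgn X]eq_fun do rewrite -Sij; exact: cvIm.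
have hH : H \is hermsymmx.
  rewrite hermsymmxE; apply/eqP/matrixP => i j; rewrite !mxE.
  have := ccvg_conj (SH j i); rewrite mxE.
  under [X in ccvg X]eq_fun => k.
    have -> : (S k j i)^* = S k i j.
      by have := hS k; rewrite hermsymmxE => /eqP/matrixP/(_ i j); rewrite !mxE.
    over.
  by move=> /(ccvg_unique (SH i j)) <-; rewrite mxE.
have qE (M : 'M[C]_n) y : qform M y = \sum_i \sum_j ((y i 0)^* * y j 0) * M i j.
  rewrite /qform dotcE; apply: eq_bigr => i _; rewrite mxE mulr_sumr.
  by apply: eq_bigr => j _; ring.
have qlim y : v^~ y @ \oo --> complex.Re (qform H y).
  suff [] : ccvg (fun k => qform (S k) y) (qform H y) by [].
  rewrite qE; under eq_fun do rewrite qE.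
  by do 2!apply: ccvg_sum => ?; apply: ccvgMr.
have qlimE y : complex.Re (qform H y) = limn (v^~ y) by apply/esym/cvg_lim.
have Im0 (M : 'M[C]_n) y : M \is hermsymmx -> complex.Im (qform M y) = 0.
  by move=> hM; exact/ImR0/qform_real.
exists H; split.
- exact: hH.
- move=> k y; rewrite lecE (Im0 H y hH) (Im0 (S k) y (hS k)) eqxx /= qlimE.
  exact: (nonincreasing_cvgn_ge (dec y) (cv y) k).
(* The order on complex numbers requires equal imaginary parts; the bound at [k = 0] provides this
   for [a]. *)
- move=> y a ha; have := ha 0%N; rewrite !lecE (Im0 H y hH) (Im0 (S 0%N) y (hS 0%N)).
  move=> /andP[-> _] /=; rewrite qlimE; apply: limr_ge; first exact: cv.
  by apply: nearW => k; exact: ler_Re.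
Qed.

End ComplexLimits.

(** * Discrete Parseval identity on the unit circle *)

Lemma injective_avoids_seq (T : eqType) (f : nat -> T) (s : seq T) :
  injective f -> exists k, f k \notin s.
Proof.
move=> finj; apply/not_existsP => h.
have : (size [seq f k | k <- iota 0 (size s).+1] <= size s)%N.
  apply: uniq_leq_size; first by rewrite map_inj_uniq ?iota_uniq.
  by move=> _ /mapP[k _ ->]; apply/negPn/negP; exact: h.
by rewrite size_map size_iota ltnn.
Qed.

Section UnitCircle.
Variable C : numClosedFieldType.

(** X^n - 1 is separable in characteristic 0, so it has [n] distinct roots, enough for a primitive
    one. *)
Lemma prim_root_exists n : (n > 0)%N -> exists z : C, n.-primitive_root z.
Proof.
move=> n_gt0; have [s Ds] := closed_field_poly_normal ('X^n - 1 : {poly C}).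
rewrite (monicP _) ?monicXnsubC // scale1r in Ds.
have roots : all n.-unity_root s by apply/allP => z; rewrite -root_prod_XsubC -Ds.
have sz : (n < (size s).+1)%N by rewrite -(size_prod_XsubC s id) -Ds size_XnsubC.
have [|z] := hasP (has_prim_root n_gt0 roots _ sz); last by exists z.
by rewrite -separable_prod_XsubC -Ds separable_Xn_sub_1 // pnatr_eq0 -lt0n.
Qed.

Lemma unit_circle_avoids_seq (s : seq C) : exists2 c : C, c * c^* = 1 & c \notin s.
Proof.
have conj_ij (k : nat) : (1 + 'i * k%:R : C)^* = 1 - 'i * k%:R.
  by rewrite rmorphD rmorph1 rmorphM /= conjCi conjC_nat mulNr.
have ij_neq0 (k : nat) : (1 + 'i * k%:R : C) * (1 - 'i * k%:R) != 0.
  have -> : (1 + 'i * k%:R : C) * (1 - 'i * k%:R) = 1 + (k ^ 2)%:R.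
    by rewrite mulrC -subr_sqr expr1n exprMn sqrCi mulN1r opprK natrX.
  by rewrite gt_eqF// ltr_pwDl// ler0n.
(* Cayley images of the points i k: infinitely many distinct points of the unit circle. *)
pose u (k : nat) : C := (1 + 'i * k%:R) / (1 - 'i * k%:R).
have uinj : injective u.
  move=> a b /eqP; have := ij_neq0 a; have := ij_neq0 b.
  rewrite !mulf_eq0 !negb_or => /andP[_ b0] /andP[_ a0]; rewrite eqr_div//.
  rewrite -subr_eq0 (_ : _ - _ = 2 * 'i * (a%:R - b%:R)); last by ring.
  rewrite !mulf_eq0 (negPf (neq0Ci _)) pnatr_eq0/= subr_eq0 eqr_nat.
  by move=> /eqP.
have [k uk] := injective_avoids_seq s uinj; exists (u k) => //.
have -> : (u k)^* = (1 - 'i * k%:R) / (1 + 'i * k%:R).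
  by rewrite /u rmorphM fmorphV /= -conj_ij conjCK conj_ij.
by rewrite /u mulf_div [X in X / _]mulrC divff// mulrC.
Qed.

(** The nodes are the roots of unity of order [N], rotated by a unit factor [c] that avoids finitely
    many values; orthogonality is a geometric sum. *)
Lemma equidistributed_nodes N (s : seq C) : (0 < N)%N ->
  exists z : 'I_N -> C, [/\ forall k, z k * (z k)^* = 1, forall k, z k \notin s &
    forall i j : 'I_N, \sum_k z k ^+ i * (z k ^+ j)^* = (i == j)%:R * N%:R].
Proof.
move=> N0; have [zeta pz] := prim_root_exists N0.
have zN : zeta ^+ N = 1 by exact: prim_expr_order.
have z0 : zeta != 0 by rewrite (prim_root_eq0 pz) -lt0n.
have zz : zeta * zeta^* = 1.
  rewrite -normCK; apply/eqP.
  by rewrite sqrf_eq1 -(eqrXn2 N0)// ?expr1n -?normrX ?zN ?normr1 ?eqxx.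
have [c cc cs] := unit_circle_avoids_seq [seq r / zeta ^+ k | r <- s, k <- iota 0 N].
exists (fun k => c * zeta ^+ k); split=> [k|k|i j].
- by rewrite rmorphM rmorphXn /= mulrACA cc -exprMn zz expr1n mulr1.
- apply: contra cs => ks; apply/allpairsP; exists (c * zeta ^+ k, k : nat).
  by rewrite /= ks mem_iota ltn_ord mulfK// expf_neq0.
have zc : zeta^* = zeta^-1 by apply: (mulfI z0); rewrite zz mulfV.
pose q := zeta ^+ i / zeta ^+ j.
have -> : \sum_(k < N) (c * zeta ^+ k) ^+ i * ((c * zeta ^+ k) ^+ j)^* =
    c ^+ i * (c^*) ^+ j * \sum_(k < N) q ^+ k.
  rewrite mulr_sumr; apply: eq_bigr => k _.
  rewrite /q rmorphXn rmorphM rmorphXn /= zc !exprMn !exprVn -!exprM.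
  by rewrite !(mulnC k); ring.
have [ij|ij] := eqVneq i j.
  have -> : q = 1 by rewrite /q ij mulfV ?expf_neq0.
  rewrite ij -exprMn cc expr1n mul1r mul1r.
  by under eq_bigr do rewrite expr1n; rewrite sumr_const card_ord.
have q1 : q - 1 != 0.
  rewrite subr_eq0 /q (can2_eq (divfK _) (mulfK _)) ?expf_neq0// mul1r.
  by rewrite (eq_prim_root_expr pz) !modn_small.
suff -> : \sum_(k < N) q ^+ k = 0 by rewrite mulr0 mul0r.
apply: (mulfI q1); rewrite -subrX1 mulr0 /q exprMn exprVn -!exprM !(mulnC _ N).
by rewrite !exprM zN !expr1n invr1 mulr1 subrr.
Qed.

Lemma parseval N n (z : 'I_N -> C) (W Y : 'I_N -> 'cV[C]_n) :
    (forall i j : 'I_N, \sum_k z k ^+ i * (z k ^+ j)^* = (i == j)%:R * N%:R) ->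
  \sum_k dotc (\sum_(t < N) (z k ^+ t)^* *: W t) (\sum_(t < N) (z k ^+ t)^* *: Y t) =
  N%:R * \sum_(t < N) dotc (W t) (Y t).
Proof.
move=> orth; under eq_bigr => k _.
  rewrite dotc_suml; under eq_bigr => i _.
    rewrite dotc_sumr; under eq_bigr do rewrite dotcZl dotcZr conjCK mulrA.
    over.
  over.
rewrite exchange_big /= mulr_sumr; apply: eq_bigr => i _.
rewrite exchange_big (bigD1 i)//= -mulr_suml orth eqxx mul1r.
by rewrite big1 ?addr0// => j ji; rewrite -mulr_suml orth eq_sym (negPf ji) !mul0r.
Qed.

End UnitCircle.

(** * Midpoint discretization *)

Definition addcc (K : numClosedFieldType) (z : K) : K := z + z^*.

Lemma addccD (K : numClosedFieldType) (x y : K) : addcc (x + y) = addcc x + addcc y.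
Proof. by rewrite /addcc rmorphD /=; ring. Qed.

Lemma addcc0 (K : numClosedFieldType) : addcc (0 : K) = 0.
Proof. by rewrite /addcc rmorph0 addr0. Qed.

Lemma addcc_sum (K : numClosedFieldType) (I : Type) (s : seq I) (F : I -> K) :
  addcc (\sum_(i <- s) F i) = \sum_(i <- s) addcc (F i).
Proof. by elim/big_rec2: _ => [|i a b _ <-]; rewrite ?addcc0 ?addccD. Qed.

Lemma addccMn (K : numClosedFieldType) N (x : K) : addcc (N%:R * x) = N%:R * addcc x.
Proof. by rewrite /addcc rmorphM /= conjC_nat mulrDr. Qed.

Lemma qform_addT (K : numClosedFieldType) n (M : 'M[K]_n) x :
  qform (M + M ^t* ) x = addcc (dotc x (M *m x)).
Proof.
rewrite /qform mulmxDl dotcDr /addcc conj_dotc.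
by rewrite [dotc x (_ ^t* *m _)]dotc_adj trmxCK.
Qed.

Lemma horner_char_poly (F : comNzRingType) n (A : 'M[F]_n) s :
  (char_poly A).[s] = \det (s%:M - A).
Proof.
rewrite /char_poly -[LHS]/(horner_eval s _) -det_map_mx; congr (\det _).
by apply/matrixP => i j; rewrite !mxE rmorphB rmorphMn /= /horner_eval hornerX hornerC.
Qed.

Section MidpointDiscretization.
Variables (K : numClosedFieldType) (n p : nat).
Variables (A : 'M[K]_n) (B : 'M[K]_(n, p)) (Cm : 'M[K]_(p, n)) (D : 'M[K]_p).
Variable a : K.
Hypotheses (a_gt0 : 0 < a) (aA : a%:M - A \in unitmx).

(* The midpoint rule a (x' - x) = A (x' + x) + B w, solved for x'. Both matrices
   are locked because [mulmxA] would otherwise unfold them. *)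
Definition midA := locked (invmx (a%:M - A) *m (a%:M + A)).
Definition midB := locked (invmx (a%:M - A) *m B).

Definition mid_supply : 'M[K]_(n + p) :=
  let M := (row_mx 0 1%:M) ^t* *m row_mx (Cm *m (1%:M + midA)) (Cm *m midB + D) in
  M + M ^t*.

Lemma midpointP (x x' : 'cV[K]_n) (w : 'cV[K]_p) :
  a *: (x' - x) = A *m (x' + x) + B *m w <-> x' = midA *m x + midB *m w.
Proof.
have -> : (a *: (x' - x) = A *m (x' + x) + B *m w) <->
    ((a%:M - A) *m x' = (a%:M + A) *m x + B *m w).
  rewrite mulmxBl mulmxDl mulmxDr !mul_scalar_mx scalerBr.
  split=> /eqP h; apply/eqP; move: h; rewrite -subr_eq0 => h; rewrite -subr_eq0;
  by congr (_ == _): h; rewrite !opprD; apply/matrixP => i j; rewrite !mxE; ring.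
rewrite /midA /midB -!lock -!mulmxA -mulmxDr; split=> [<-|->]; first by rewrite mulKmx.
by rewrite mulKVmx.
Qed.

Lemma mid_supplyE (x : 'cV[K]_n) (w : 'cV[K]_p) : qform mid_supply (col_mx x w) =
  addcc (dotc w (Cm *m (midA *m x + midB *m w + x) + D *m w)).
Proof.
rewrite /mid_supply qform_addT -mulmxA dotc_adj trmxCK !mul_row_col mul0mx add0r mul1mx.
rewrite !(mulmxDl, mulmxDr) mulmx1 !mulmxA; congr (addcc (dotc w _)).
by apply/matrixP => i j; rewrite !mxE; ring.
Qed.

(** Positivity on the imaginary axis, off the spectrum of [A], stated on solutions of s x = A x + B
    w so that no inverse occurs. *)
Hypothesis fdi : forall s (x : 'cV[K]_n) (w : 'cV[K]_p),
  s^* = - s -> (char_poly A).[s] != 0 ->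
  s *: x = A *m x + B *m w -> 0 <= addcc (dotc w (Cm *m x + D *m w)).

Lemma cost_sum Sg x us : cost midA midB Sg x us =
  \sum_(t < size us) qform Sg (col_mx (traj midA midB x (take t us)) us`_t).
Proof. by elim: us x => [|w us IH] x; rewrite ?big_ord0//= big_ord_recl IH take0. Qed.

(** The discrete Fourier transform of a loop at a node z turns the midpoint rule into s x = A x + B
    w with s = a (z - 1) / (z + 1). By Parseval the cost is an average of supplies that [fdi] makes
    nonnegative. *)
Lemma loop_cost_ge0 us : traj midA midB 0 us = 0 ->
  0 <= cost midA midB mid_supply 0 us.
Proof.
move=> loop; rewrite cost_sum; set N := size us.
have [N0|N0] := posnP N; first by rewrite N0 big_ord0.
pose X t := traj midA midB 0 (take t us); pose W t := us`_t.
have X0 : X 0%N = 0 by rewrite /X take0.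
have XN : X N = 0 by rewrite /X take_size.
have step t : (t < N)%N -> X t.+1 = midA *m X t + midB *m W t.
  by move=> tN; rewrite /X (take_nth 0)// traj_rcons.
pose xi t := X t.+1 + X t; pose Y t := Cm *m xi t + D *m W t.
have -> : \sum_(t < N) qform mid_supply (col_mx (X t) (W t)) =
    addcc (\sum_(t < N) dotc (W t) (Y t)).
  rewrite addcc_sum; apply: eq_bigr => t _.
  by rewrite mid_supplyE -step.
have [rs chi] := closed_field_poly_normal (char_poly A).
have chia : (char_poly A).[a] != 0 by rewrite horner_char_poly -unitfE -unitmxE.
(* Excluded are z = -1, where s is infinite, and the z for which s is an eigenvalue of [A]. *)
have [z [zz zs orth]] :=
  equidistributed_nodes (-1 :: [seq (a + l) / (a - l) | l <- rs]) N0.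
rewrite -(pmulr_rge0 _ (_ : 0 < N%:R)) ?ltr0n// -addccMn -(parseval _ _ orth) addcc_sum.
apply: sumr_ge0 => k _.
have {zs}[z1 zr] : z k + 1 != 0 /\ z k \notin [seq (a + l) / (a - l) | l <- rs].
  by have := zs k; rewrite inE negb_or addr_eq0 => /andP[].
pose s := a * (z k - 1) / (z k + 1).
pose hat m (F : nat -> 'cV[K]_m) := \sum_(t < N) (z k ^+ t)^* *: F t.
have hatD m (F G : nat -> 'cV[K]_m) : hat m (fun t => F t + G t) = hat m F + hat m G.
  by rewrite /hat -big_split; apply: eq_bigr => t _; rewrite scalerDr.
have hatM m l (M : 'M[K]_(m, l)) F : hat m (fun t => M *m F t) = M *m hat l F.
  by rewrite /hat mulmx_sumr; apply: eq_bigr => t _; rewrite scalemxAr.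
have z0 : z k != 0.
  by apply/eqP => z0; have := zz k; rewrite z0 mul0r => /eqP; rewrite eq_sym oner_eq0.
(* Both end states [X 0] and [X N] vanish, so a shift multiplies the transform by z without boundary
   terms. *)
have hatS : hat n (fun t => X t.+1) = z k *: hat n X.
  pose F t := (z k ^+ t)^* *: X t.
  have <- : \sum_(t < N) F t.+1 = hat n X.
    have := erefl (\sum_(t < N.+1) F t); rewrite {1}big_ord_recl big_ord_recr /=.
    by rewrite /F /= X0 XN !scaler0 add0r addr0.
  rewrite scaler_sumr; apply: eq_bigr => t _.
  by rewrite /F scalerA exprS rmorphM mulrA zz mul1r.
rewrite -/(hat p W) -/(hat p Y).
have -> : hat p Y = Cm *m hat n xi + D *m hat p W by rewrite hatD !hatM.
apply: (@fdi s).
- have zc : (z k)^* = (z k)^-1 by apply: (mulfI z0); rewrite zz mulfV.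
  rewrite /s rmorphM fmorphV rmorphM rmorphB rmorphD rmorph1 /= zc geC0_conj ?ltW//.
  by field; rewrite z1.
- apply: contraNneq zr; rewrite chi (monicP (char_poly_monic A)) scale1r => /eqP.
  rewrite -/(root _ _) root_prod_XsubC => srs; apply/mapP; exists s => //.
  have -> : a + s = 2 * a * z k / (z k + 1) by rewrite /s; field.
  have -> : a - s = 2 * a / (z k + 1) by rewrite /s; field.
  have a0 : a != 0 by rewrite gt_eqF.
  by field; rewrite a0 z1.
- have -> : hat n xi = (z k + 1) *: hat n X by rewrite hatD hatS scalerDl scale1r.
  rewrite scalerA divfK//.
  have -> : A *m ((z k + 1) *: hat n X) + B *m hat p W =
      hat n (fun t => A *m xi t + B *m W t).
    by rewrite hatD !hatM hatD hatS scalerDl scale1r.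
  have -> : hat n (fun t => A *m xi t + B *m W t) =
      hat n (fun t => a%:M *m (X t.+1 + (- 1%:M) *m X t)).
    apply: eq_bigr => t _; congr (_ *: _).
    by rewrite mul_scalar_mx mulNmx mul1mx; apply/esym/midpointP/step.
  by rewrite hatM hatD hatM hatS mulNmx mul1mx mul_scalar_mx -scalerA scalerBl scale1r.
Qed.

End MidpointDiscretization.

(** * The inequality on the reachable space *)

Lemma eq_mulmx_col (F : fieldType) m n (M N : 'M[F]_(m, n)) :
  (forall y : 'cV_n, M *m y = N *m y) -> M = N.
Proof.
move=> h; apply/matrixP => i j.
by have /colP/(_ i) := h (delta_mx j 0); rewrite -!colE !mxE.
Qed.

Section KYP.
Variables (R : realType) (n p : nat).
Local Notation K := R[i].
Variables (A : 'M[K]_n) (B : 'M[K]_(n, p)) (Cm : 'M[K]_(p, n)) (D : 'M[K]_p).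

Hypothesis fdi : forall s (x : 'cV[K]_n) (w : 'cV[K]_p),
  s^* = - s -> (char_poly A).[s] != 0 ->
  s *: x = A *m x + B *m w -> 0 <= addcc (dotc w (Cm *m x + D *m w)).

(** [Q] projects onto the reachable space, which is invariant under [A] and contains the range of
    [B]; the inequality is obtained for states in that space. *)
Lemma kyp_reachable : exists Q H : 'M[K]_n,
  [/\ H \is hermsymmx, Q *m Q = Q, Q *m A *m Q = A *m Q, Q *m B = B &
   forall x w, Q *m x = x ->
     0 <= addcc (dotc x (H *m (A *m x + B *m w)) + dotc w (Cm *m x + D *m w))].
Proof.
(* A positive integer that is not an eigenvalue of [A]. *)
have [a a0 aA] : exists2 a : K, 0 < a & a%:M - A \in unitmx.
  have [rs chi] := closed_field_poly_normal (char_poly A).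
  have inj : injective (fun k : nat => k.+1%:R : K).
    by move=> i j /eqP; rewrite eqr_nat => /eqP [].
  have [k kN] := injective_avoids_seq rs inj; exists k.+1%:R; first exact: ltr0Sn.
  rewrite unitmxE unitfE -horner_char_poly chi (monicP (char_poly_monic A)) scale1r.
  by rewrite -/(root _ _) root_prod_XsubC.
have hSg : mid_supply A B Cm D a \is hermsymmx by exact: herm_addT.
have [Q [S [[QQ reachQ Qtraj] [hS decS bndS disS]]]] :=
  value_sequence hSg (loop_cost_ge0 a0 aA fdi).
have [H [hH HS HG]] := herm_monotone_limit hS decS bndS.
have QmA : Q *m midA A a *m Q = midA A a *m Q.
  apply: eq_mulmx_col => y; rewrite -!mulmxA; have [us <-] := reachQ y.
  have := Qtraj (rcons us 0); rewrite traj_rcons mulmx0 addr0; exact.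
have QmB : Q *m midB A B a = midB A B a.
  apply: eq_mulmx_col => w; rewrite -!mulmxA.
  by have := Qtraj [:: w]; rewrite /= mulmx0 add0r.
pose E := invmx (a%:M - A).
have aE : (a%:M - A) *m E = 1%:M by rewrite mulmxV.
(* This identity carries invariance of the reachable space from [midA] to the resolvent [E]. *)
have mAE : midA A a + 1%:M = (2 * a) *: E.
  rewrite /midA -lock -/E -[1%:M](mulVmx aA) -/E -mulmxDr.
  have -> : a%:M + A + (a%:M - A) = (2 * a)%:M.
    by apply/matrixP => i j; rewrite !mxE; case: eqP => _ /=; ring.
  by rewrite mul_mx_scalar.
have a2 : 2 * a != 0 by rewrite mulf_neq0 ?pnatr_eq0// gt_eqF.
have QE : E *m Q = Q *m (E *m Q).
  have -> : E = (2 * a)^-1 *: (midA A a + 1%:M) by rewrite mAE scalerA mulVf// scale1r.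
  by rewrite -!scalemxAl -!scalemxAr mulmxDl mulmxDr mulmxA QmA mul1mx QQ.
(* [E] is invertible and maps the range of [Q] into itself, hence onto itself by rank; so a - A
   preserves this range too. *)
have [Z QZ] : exists Z, Q = E *m Q *m Z.
  apply: (colspan_rank_factor QE).
  by rewrite -{1}[Q]mul1mx -aE -mulmxA mxrankM_maxr.
have aAQ : Q *m (a%:M - A) *m Q = (a%:M - A) *m Q.
  have -> : (a%:M - A) *m Q = Q *m Z by rewrite {1}QZ !mulmxA aE mul1mx.
  rewrite -mulmxA [_ *m Q](_ : _ = Q *m Z); first by rewrite mulmxA QQ.
  by rewrite {1}QZ !mulmxA aE mul1mx.
have QA : Q *m A *m Q = A *m Q.
  move: aAQ; rewrite mulmxBr !mulmxBl mul_mx_scalar -scalemxAl QQ mul_scalar_mx.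
  by move=> /addrI/oppr_inj.
have QB : Q *m B = B.
  have -> : B = (a%:M - A) *m midB A B a by rewrite /midB -lock mulKVmx.
  by rewrite -QmB !mulmxA aAQ.
exists Q, (- (2 * a)^-1 *: H); split=> // [|x w Qx].
  by rewrite herm_scale// rpredN rpredV gtr0_real// mulr_gt0// ltr0n.
pose e := A *m x + B *m w; pose b := (2 * a)^-1.
have Qe : Q *m e = e.
  have QAx : Q *m (A *m x) = A *m x by rewrite -{1}Qx !mulmxA QA -mulmxA Qx.
  by rewrite /e mulmxDr QAx (mulmxA Q B) QB.
(* The ends of a midpoint step: their sum is [x] and their difference is e / a. *)
pose x1 := b *: e + 2^-1 *: x; pose x0 := - b *: e + 2^-1 *: x.
have x10 : x1 + x0 = x.
  have half : 2^-1 + 2^-1 = 1 :> K by field.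
  by rewrite /x1 /x0 addrACA -!scalerDl addrN scale0r add0r half scale1r.
have next : x1 = midA A a *m x0 + midB A B a *m w.
  apply/(midpointP B aA); rewrite x10 -/e /x1 /x0 opprD addrACA subrr addr0.
  rewrite scaleNr opprK -scalerDl scalerA.
  have -> : a * (b + b) = 1 by rewrite /b; field; rewrite gt_eqF.
  by rewrite scale1r.
have Qx0 : Q *m x0 = x0 by rewrite /x0 mulmxDr -!scalemxAr Qe Qx.
(* For every [k], the limit form at [x1] is at most [S k] at [x0] plus the supply; in the limit
   [S k] becomes [H]. *)
have dis : qform H x1 - qform H x0 <= addcc (dotc w (Cm *m x + D *m w)).
  rewrite lerBlDl -lerBlDr; apply: HG => k; rewrite lerBlDr.
  apply: (le_trans (HS k.+1 _)); rewrite [in X in X <= _]next.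
  apply: (le_trans (disS k _ _ Qx0)).
  by rewrite lerD2l mid_supplyE -next x10.
(* The ends are x / 2 + b e and x / 2 - b e, so only the cross term survives. *)
have diff : qform H x1 - qform H x0 = addcc (b * dotc x (H *m e)).
  have -> : x1 = 2^-1 *: x + b *: e by rewrite addrC.
  have -> : x0 = 2^-1 *: x + - b *: e by rewrite addrC.
  rewrite !qformD// !qformZ -!scalemxAr !dotcZl !dotcZr /addcc.
  have b_real : b^* = b by rewrite geC0_conj// invr_ge0 mulr_ge0 ?ler0n ?ltW.
  have h_real : (2^-1 : K)^* = 2^-1 by rewrite geC0_conj// invr_ge0 ler0n.
  by rewrite !rmorphM !rmorphN /= h_real b_real; field.
have {}dis : 0 <= addcc (dotc w (Cm *m x + D *m w)) - addcc (b * dotc x (H *m e)).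
  by rewrite subr_ge0 -diff.
congr (_ <= _): dis; rewrite addccD addrC -scalemxAl dotcZr mulNr.
by congr (_ + _); rewrite /addcc rmorphN opprD.
Qed.

End KYP.

(** * Signatures, Lyapunov-type inequalities and transfer functions *)

Section Signature.
Variable K : numClosedFieldType.

Lemma congr_diagE n (G : 'M[K]_n) d i j :
  (G ^t* *m diag_mx d *m G) i j = \sum_k (G k i)^* * d ord0 k * G k j.
Proof.
by rewrite mul_mx_diag mxE; apply: eq_bigr => k _; rewrite !mxE.
Qed.

Lemma perm_count n (P : pred 'I_n) :
  exists s : 'S_n, forall i, P (s i) = (i < #|P|)%N.
Proof.
pose t := [tuple ~~ P i | i < n].
pose l := nseq #|P| false ++ nseq (n - #|P|) true.
have : perm_eq l t.
  have cP : count negb t = #|P|.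
    rewrite count_map -sum1_card -sum1_count big_enum_cond.
    by apply: eq_bigl => i /=; rewrite negbK.
  rewrite perm_sym -(perm_filterC negb t).
  have /all_pred1P -> : all (pred1 false) [seq x <- t | ~~ x].
    by apply/allP => x; rewrite mem_filter /= => /andP[/negPf ->].
  have /all_pred1P -> : all (pred1 true) [seq x <- t | predC negb x].
    by apply/allP => x; rewrite mem_filter /= negbK => /andP[->].
  have := count_predC negb t; rewrite size_tuple cP => /(congr1 (subn^~ #|P|)).
  by rewrite addKn !size_filter cP => ->.
move=> /tuple_permP[s ls]; exists s => i.
have := congr1 (fun l => nth true l i) ls.
rewrite -tnth_nth !tnth_mktuple nth_cat size_nseq !nth_nseq.
by case: (_ < #|P|)%N; rewrite ?if_same; case: (P _).
Qed.

(** Sylvester normal form: in the spectral decomposition, eigenvalues are rescaled to their signs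
    and the negative ones permuted to the front. *)
Lemma hermitian_signature n (H : 'M[K]_n) : H \is hermsymmx ->
  exists nu (d : 'rV[K]_n) (T : 'M[K]_n), [/\ (nu <= n)%N, T \in unitmx,
    H = T ^t* *m diag_mx d *m T &
    forall i : 'I_n, if (i < nu)%N then d ord0 i = -1
      else (d ord0 i = 0) \/ (d ord0 i = 1)].
Proof.
move=> hH; pose P := spectralmx H; pose sp := spectral_diag H.
have HP : H = P ^t* *m diag_mx sp *m P.
  have := orthomx_spectralP (hermitian_normalmx hH).
  by rewrite invmx_unitary ?spectral_unitarymx.
have sp_real i : sp ord0 i \is Num.real.
  by have /mxOverP := hermitian_spectral_diag_real hH; apply.
have [s hs] := perm_count (fun i => sp ord0 i < 0).
set nu := #|_| in hs.
pose d0 i : K := if sp ord0 i < 0 then -1 else if sp ord0 i == 0 then 0 else 1.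
(* The value 1 at zero eigenvalues keeps the scaling invertible. *)
pose g i : K := if sp ord0 i == 0 then 1 else sqrtC `|sp ord0 i|.
have g0 i : g i != 0.
  by rewrite /g; case: ifP => [_|/negbT h]; rewrite ?oner_neq0// sqrtC_eq0 normr_eq0.
have gd i : (g i)^* * d0 i * g i = sp ord0 i.
  rewrite /g /d0; case: ifP => [/eqP -> |sp0]; first by rewrite ltxx mulr0 mul0r.
  rewrite geC0_conj ?sqrtC_ge0// mulrAC -expr2 sqrtCK.
  have /orP[sp1|sp1] := sp_real i.
    by rewrite ger0_norm// (le_gtF sp1) mulr1.
  by rewrite ler0_norm// lt_neqAle sp0 sp1 mulrN1 opprK.
pose G := diag_mx (\row_i g i) *m P.
exists nu, (\row_i d0 (s i)), (row_perm s G); split.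
- by rewrite -[X in (_ <= X)%N]card_ord max_card.
- rewrite row_permE unitmx_mul unitmx_perm unitmx_mul spectral_unit andbT.
  by rewrite unitmxE det_diag; apply/unitr_prod => i _; rewrite mxE unitfE.
- have GE k j : G k j = g k * P k j by rewrite /G mul_diag_mx !mxE.
  apply/matrixP => i j; rewrite HP !congr_diagE [LHS](reindex_inj (@perm_inj _ s)).
  apply: eq_bigr => k _; rewrite ![row_perm _ _ _ _]mxE [(\row_i _) _ _]mxE !GE.
  by rewrite rmorphM /= -gd; ring.
- move=> i; rewrite mxE /d0 -hs; case: ifP => [-> //|->].
  by case: ifP => _; [left|right].
Qed.

End Signature.

Section Realizations.
Variable R : realType.
Local Notation K := R[i].

(** As [H] is Hermitian, the two summands defining [Lbar] are adjoint to each other, so their sum is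
    Hermitian and its form is twice a real part. *)
Lemma LbarP m (H L : 'M[K]_m) : H \is hermsymmx ->
  Lbar H L <-> forall v, 0 <= addcc (dotc v (H *m (L *m v))).
Proof.
move=> hH; have HH : L ^t* *m H = (H *m L) ^t*.
  by move: hH; rewrite hermsymmxE => /eqP {1}<-; rewrite trmx_mul map_mxM.
rewrite /Lbar /psd /= HH; split=> [[_ h] v|h].
  by have := h v; rewrite -qformE qform_addT mulmxA.
split=> [|v]; first exact: herm_addT.
by rewrite -qformE qform_addT -mulmxA.
Qed.

Lemma diag2_herm m k (A : 'M[K]_m) (B : 'M[K]_k) :
  A \is hermsymmx -> B \is hermsymmx -> diag2 A B \is hermsymmx.
Proof.
rewrite !hermsymmxE /diag2 => /eqP hA /eqP hB.
by rewrite tr_block_mx map_block_mx !trmx0 !map_mx0 hA hB.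
Qed.

Lemma herm1 m : (1%:M : 'M[K]_m) \is hermsymmx.
Proof. by rewrite hermsymmxE trmx1 map_mx1. Qed.

Lemma Lbar_blockP n p (H A : 'M[K]_n) (B : 'M[K]_(n, p)) Cm D : H \is hermsymmx ->
  Lbar (diag2 H 1%:M) (block_mx A B Cm D) <->
  forall x w, 0 <= addcc (dotc x (H *m (A *m x + B *m w)) + dotc w (Cm *m x + D *m w)).
Proof.
move=> hH; rewrite LbarP ?diag2_herm ?herm1//.
have vE x w : dotc (col_mx x w) (diag2 H 1%:M *m (block_mx A B Cm D *m col_mx x w)) =
    dotc x (H *m (A *m x + B *m w)) + dotc w (Cm *m x + D *m w).
  by rewrite /diag2 !mul_block_col !mul0mx addr0 add0r mul1mx dotc_col_mx.
split=> [h x w|h v]; first by rewrite -vE.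
by rewrite -[v]vsubmxK vE.
Qed.

(** The vector (x, 0) is isotropic for a nonnegative Hermitian form, hence in its kernel. Thus the
    kernel of [H] is invariant under [A] and unobservable. *)
Lemma lmi_kernel n p (H A : 'M[K]_n) (B : 'M[K]_(n, p)) Cm D
    (x : 'cV[K]_n) : H \is hermsymmx ->
  (forall (x : 'cV[K]_n) (w : 'cV[K]_p),
    0 <= addcc (dotc x (H *m (A *m x + B *m w)) + dotc w (Cm *m x + D *m w))) ->
  H *m x = 0 -> H *m A *m x = 0 /\ Cm *m x = 0.
Proof.
move=> hH lmi Hx; pose G := diag2 H (1%:M : 'M[K]_p); pose L := block_mx A B Cm D.
have hG : G \is hermsymmx by rewrite diag2_herm ?herm1.
have lbar : forall v, 0 <= addcc (dotc v (G *m L *m v)).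
  by move=> v; rewrite -mulmxA; move: v; apply/LbarP => //; apply/Lbar_blockP.
have Gx : G *m col_mx x 0 = 0.
  by rewrite /G /diag2 mul_block_col !mulmx0 mul0mx !addr0 Hx col_mx0.
have GLx : G *m L *m col_mx x 0 = 0.
  set N := G *m L + (G *m L) ^t*; have hN : N \is hermsymmx by exact: herm_addT.
  have N0 : N *m col_mx x 0 = 0.
    apply/eqP; rewrite -dotc_eq0 -herm_dotc//; apply/eqP/isotropic_dotc_eq0 => //.
      by rewrite qform_addT -mulmxA herm_dotc// Gx dotc0l addcc0.
    by exists 0 => t; rewrite qform_addT lbar.
  move: N0; rewrite /N mulmxDl trmx_mul map_mxM /=.
  move: hG; rewrite hermsymmxE => /eqP ->.
  by rewrite -[_ *m G *m _]mulmxA Gx mulmx0 addr0.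
have : G *m (L *m col_mx x 0) = 0 by rewrite mulmxA.
rewrite /G /L /diag2 !mul_block_col !mulmx0 !addr0 !mul0mx addr0 add0r mul1mx mulmxA.
by rewrite -col_mx0 => /eq_col_mx[].
Qed.

(** [S] intertwines s - A1 and s - A2, hence their inverses; it may be singular, which allows
    projections. *)
Lemma transfer_intertwine n m p (A1 : 'M[K]_n) (A2 : 'M[K]_m) (B1 : 'M[K]_(n, p))
    (B2 : 'M[K]_(m, p)) (C1 : 'M[K]_(p, n)) (C2 : 'M[K]_(p, m)) D (S : 'M[K]_(n, m)) :
  A1 *m S = S *m A2 -> B1 = S *m B2 -> C2 = C1 *m S ->
  transfer (block_mx A1 B1 C1 D) = transfer (block_mx A2 B2 C2 D).
Proof.
move=> AS -> ->; rewrite /transfer !block_mxKul !block_mxKur !block_mxKdl !block_mxKdr.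
congr (_ + _); rewrite /const_ratmx.
have constE k l (M : 'M[K]_(k, l)) :
    map_mx (fun c => FracField.tofrac c%:P) M =
    map_mx (@FracField.tofrac _) (map_mx polyC M).
  by rewrite -map_mx_comp.
rewrite !constE !map_mxM !mulmxA; congr (_ *m _); rewrite -!mulmxA; congr (_ *m _).
set P1 := map_mx _ (char_poly_mx A1); set P2 := map_mx _ (char_poly_mx A2).
have PS : P1 *m map_mx (@FracField.tofrac _) (map_mx polyC S) =
    map_mx (@FracField.tofrac _) (map_mx polyC S) *m P2.
  rewrite -!map_mxM; congr map_mx; rewrite /char_poly_mx mulmxBl mulmxBr.
  by rewrite -!map_mxM AS mul_scalar_mx mul_mx_scalar.
rewrite -[RHS](mulKmx (char_poly_mx_unit A1)) -/P1 (mulmxA P1) PS.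
by rewrite mulmxK ?char_poly_mx_unit.
Qed.

End Realizations.

Lemma Emx_herm (R : realType) nu l : Emx R nu l \is hermsymmx.
Proof.
rewrite hermsymmxE tr_diag_mx map_diag_mx; apply/eqP; congr diag_mx.
by apply/rowP => i; rewrite !mxE; case: ifP => _; rewrite ?rmorphN rmorph1.
Qed.

Section LMI.
Variable R : realType.
Local Notation K := R[i].

(* With H = T^* d T, the map x |-> d^2 T x kills the kernel of H, on which the
   system is unobservable, without changing the dimension of the state space. *)
Lemma lmi_signature n p (H A : 'M[K]_n) (B : 'M[K]_(n, p)) Cm D : H \is hermsymmx ->
    (forall (x : 'cV[K]_n) (w : 'cV[K]_p),
      0 <= addcc (dotc x (H *m (A *m x + B *m w)) + dotc w (Cm *m x + D *m w))) ->
  exists2 nu, (nu <= n)%N & exists2 L : 'M[K]_(n + p),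
    Lbar (diag2 (Emx R nu n) 1%:M) L & transfer (block_mx A B Cm D) = transfer L.
Proof.
move=> hH lmi; have [nu [d [T [nun uT HT hd]]]] := hermitian_signature hH.
(* The entries of [d] are -1, 0 or 1, so its square [P] is a projection. *)
pose De := diag_mx d; pose P := diag_mx (\row_i (d ord0 i ^+ 2)).
pose E := Emx R nu n.
have dd i : d ord0 i ^+ 2 * d ord0 i = d ord0 i.
  have := hd i; case: ifP => _ => [->|[->|->]]; rewrite ?sqrrN ?expr1n ?mul1r//.
  by rewrite mulr0.
have PP : P *m P = P.
  rewrite mulmx_diag; congr diag_mx; apply/rowP => i; rewrite !mxE.
  by rewrite -exprD -(mulr1 (_ ^+ 2)) [_ ^+ 2]expr2 -{3}dd !expr2; ring.
have PDe : P *m De = De.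
  by rewrite mulmx_diag; congr diag_mx; apply/rowP => i; rewrite !mxE dd.
have DeP : De *m P = De.
  by rewrite mulmx_diag; congr diag_mx; apply/rowP => i; rewrite !mxE mulrC dd.
have DeDe : De *m De = P.
  by rewrite mulmx_diag; congr diag_mx; apply/rowP => i; rewrite !mxE expr2.
(* Where [d] is 0 the signature [E] has 1, and [P] erases the difference. *)
have EP : E *m P = De.
  rewrite mulmx_diag; congr diag_mx; apply/rowP => i; rewrite !mxE.
  have := hd i; case: ifP => _ => [->|[->|->]]; rewrite ?sqrrN ?expr1n ?mulr1 ?mul1r//.
  by rewrite expr0n.
have Pherm : P ^t* = P.
  rewrite tr_diag_mx map_diag_mx; congr diag_mx; apply/rowP => i; rewrite !mxE.
  have := hd i; case: ifP => _ => [->|[->|->]]; rewrite ?sqrrN ?expr1n ?rmorph1//.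
  by rewrite expr0n rmorph0.
pose Ti : 'M[K]_n := invmx T.
have TTi : T *m Ti = 1%:M by rewrite mulmxV.
have TiT : Ti *m T = 1%:M by rewrite mulVmx.
have kerP (x : 'cV[K]_n) : P *m x = 0 ->
    P *m T *m A *m Ti *m x = 0 /\ Cm *m Ti *m x = 0.
  move=> Px; have Hx : H *m (Ti *m x) = 0.
    by rewrite HT !mulmxA -(mulmxA _ T) TTi mulmx1 -/De -DeP -!mulmxA Px !mulmx0.
  have [HA ?] := lmi_kernel hH lmi Hx; split; last by rewrite -mulmxA.
  have uTs : T ^t* \in unitmx by rewrite map_unitmx unitmx_tr.
  have {}HA : De *m T *m A *m (Ti *m x) = 0.
    move: HA; rewrite HT -!(mulmxA (T ^t* )).
    by move=> /(congr1 (mulmx (invmx (T ^t* )))); rewrite mulKmx// mulmx0.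
  by rewrite -DeDe -!mulmxA (mulmxA T) (mulmxA De (T *m A)) (mulmxA De T) HA mulmx0.
have kerP' m (M : 'M[K]_(m, n)) :
    (forall x : 'cV[K]_n, P *m x = 0 -> M *m x = 0) -> M *m P = M.
  move=> h; apply: eq_mulmx_col => y; apply/eqP.
  rewrite -subr_eq0 -opprB oppr_eq0 -mulmxA.
  by rewrite -mulmxBr h// mulmxBr mulmxA PP subrr.
have PA : P *m T *m A *m Ti *m P = P *m T *m A *m Ti by apply: kerP' => x /kerP[].
have CP : Cm *m Ti *m P = Cm *m Ti by apply: kerP' => x /kerP[].
exists nu => //.
exists (block_mx (P *m T *m A *m Ti *m P) (P *m T *m B) (Cm *m Ti *m P) D).
  apply/Lbar_blockP.
    exact: Emx_herm.
  (* The form of the new realization at (x, w) is that of the given one at (u, w). *)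
  move=> x w; pose u : 'cV[K]_n := Ti *m (P *m x).
  have TU : T *m u = P *m x by rewrite /u mulmxA TTi mul1mx.
  have -> : Cm *m Ti *m P *m x = Cm *m u by rewrite /u !mulmxA.
  suff -> : dotc x (E *m (P *m T *m A *m Ti *m P *m x + P *m T *m B *m w)) =
      dotc u (H *m (A *m u + B *m w)) by exact: lmi.
  set y := A *m u + B *m w.
  have -> : P *m T *m A *m Ti *m P *m x + P *m T *m B *m w = P *m (T *m y).
    by rewrite /y /u !mulmxDr !mulmxA.
  rewrite (mulmxA E P) EP -PDe -(mulmxA P De) [LHS]dotc_adj Pherm -TU HT.
  by rewrite -(mulmxA _ T y) -(mulmxA _ De) [RHS]dotc_adj trmxCK.
apply/esym; apply: (@transfer_intertwine _ _ _ _ _ _ _ _ _ _ D (P *m T)) => //.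
- by rewrite PA (mulmxA _ P T) PA -(mulmxA _ Ti T) TiT mulmx1.
- by rewrite CP (mulmxA _ P T) CP -(mulmxA _ Ti T) TiT mulmx1.
Qed.

End LMI.

(** * Evaluation of transfer functions *)

Section Evaluation.
Variables (R : realType) (n p : nat).
Local Notation K := R[i].
Variables (A : 'M[K]_n) (B : 'M[K]_(n, p)) (Cm : 'M[K]_(p, n)) (D : 'M[K]_p).
Let L := block_mx A B Cm D.

(** Cramer's rule: numerators over the common denominator [char_poly A], without cancellation. *)
Definition transfer_num : 'M[{poly K}]_p :=
  map_mx polyC Cm *m \adj (char_poly_mx A) *m map_mx polyC B
  + char_poly A *: map_mx polyC D.

Lemma transfer_numE i j : transfer L i j =
  FracField.tofrac (transfer_num i j) / FracField.tofrac (char_poly A).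
Proof.
pose tf := @FracField.tofrac {poly K}.
have chi0 : tf (char_poly A) != 0 by rewrite tofrac_eq0 monic_neq0 ?char_poly_monic.
have constE k l (M : 'M[K]_(k, l)) : const_ratmx M = map_mx tf (map_mx polyC M).
  by rewrite -map_mx_comp.
suff -> : transfer L = (tf (char_poly A))^-1 *: map_mx tf transfer_num.
  by rewrite !mxE mulrC.
rewrite /transfer /L block_mxKul block_mxKur block_mxKdl block_mxKdr !constE.
rewrite /invmx char_poly_mx_unit det_map_mx -/(char_poly A) -map_mx_adj.
rewrite -scalemxAr -scalemxAl -!map_mxM /transfer_num map_mxD scalerDr; congr (_ + _).
by rewrite map_mxZ scalerA mulVf// scale1r.
Qed.

Lemma horner_transfer_num s : (char_poly A).[s] != 0 ->
  map_mx (horner_eval s) transfer_num =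
    (char_poly A).[s] *: (Cm *m invmx (s%:M - A) *m B + D).
Proof.
move=> chi0; have u : s%:M - A \in unitmx.
  by rewrite unitmxE unitfE -horner_char_poly.
have evC k l (M : 'M[K]_(k, l)) : map_mx (horner_eval s) (map_mx polyC M) = M.
  by apply/matrixP => i j; rewrite !mxE /horner_eval hornerC.
have evchar : map_mx (horner_eval s) (char_poly_mx A) = s%:M - A.
  apply/matrixP => i j.
  by rewrite !mxE rmorphB rmorphMn /= /horner_eval hornerX hornerC.
rewrite /transfer_num map_mxD map_mxZ !map_mxM !evC map_mx_adj evchar scalerDr.
congr (_ + _); rewrite /invmx u -horner_char_poly.
by rewrite -scalemxAr -scalemxAl scalerA mulfV// scale1r.
Qed.

Lemma ratmx_evalE s i j : (char_poly A).[s] != 0 ->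
  ratmx_eval (transfer L) s i j = (transfer_num i j).[s] / (char_poly A).[s].
Proof. by move=> chi0; rewrite mxE transfer_numE rat_evalE. Qed.

Lemma ratmx_eval_transfer s : (char_poly A).[s] != 0 ->
  ratmx_eval (transfer L) s = Cm *m invmx (s%:M - A) *m B + D.
Proof.
move=> chi0; apply/matrixP => i j; rewrite ratmx_evalE//.
have /matrixP/(_ i j) := horner_transfer_num chi0; rewrite !mxE /horner_eval => ->.
by rewrite mulrC mulKf.
Qed.

(** Bridge from values of the transfer function to inequalities in (x, w). *)
Lemma state_of_input s (w : 'cV[K]_p) : (char_poly A).[s] != 0 ->
  let x := invmx (s%:M - A) *m (B *m w) in
  s *: x = A *m x + B *m w /\
  ratmx_eval (transfer L) s *m w = Cm *m x + D *m w.
Proof.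
move=> chi0 x; have u : s%:M - A \in unitmx.
  by rewrite unitmxE unitfE -horner_char_poly.
split; last by rewrite ratmx_eval_transfer// mulmxDl !mulmxA.
have : (s%:M - A) *m x = B *m w by rewrite mulKVmx.
by rewrite mulmxBl mul_scalar_mx => /eqP; rewrite subr_eq addrC => /eqP.
Qed.

Lemma input_state s (x : 'cV[K]_n) (w : 'cV[K]_p) : (char_poly A).[s] != 0 ->
  s *: x = A *m x + B *m w ->
  Cm *m x + D *m w = ratmx_eval (transfer L) s *m w.
Proof.
move=> chi0 sx; have u : s%:M - A \in unitmx.
  by rewrite unitmxE unitfE -horner_char_poly.
have [_ ->] := state_of_input w chi0; congr (Cm *m _ + _).
suff <- : (s%:M - A) *m x = B *m w by rewrite mulKmx.
by rewrite mulmxBl mul_scalar_mx sx addrC addKr.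
Qed.

Lemma derivable_horner_num (q : {poly K}) (s : K) :
  derivable (fun z : K^o => q.[z] : K^o) s 1.
Proof.
elim/poly_ind: q => [|q c IH].
  under eq_fun do rewrite horner0; exact: derivable_cst.
under eq_fun do rewrite hornerMXaddC.
apply: derivableD; last exact: derivable_cst.
apply: derivableM; [exact: IH|exact: derivable_id].
Qed.

Lemma analytic_transfer (U : set K) : open (U : set K^o) ->
  (forall s, U s -> (char_poly A).[s] != 0) -> analytic_in (transfer L) U.
Proof.
move=> Uo chi s Us i j.
apply: (@near_eq_derivable _ _ _
   (fun z : K^o => (transfer_num i j).[z] / (char_poly A).[z] : K^o)).
  near=> z; rewrite ratmx_evalE// chi//; near: z; exact: open_nbhs_nbhs.
apply: derivableM; first exact: derivable_horner_num.
by apply: derivableV; [exact: chi|exact: derivable_horner_num].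
Unshelve. all: by end_near. Qed.

End Evaluation.

(** * Almost every point of the imaginary axis *)

Section AlmostEverywhere.
Variable R : realType.
Local Notation K := R[i].

(** By continuity a negative value persists on an interval of positive length, which a null set
    cannot contain. *)
Lemma ae_poly_ge0 (q : {poly R}) :
  {ae (@lebesgue_measure R), forall w : R, 0 <= q.[w]} -> forall w, 0 <= q.[w].
Proof.
move=> [N [mN N0 sN]] w; rewrite leNgt; apply/negP => qw.
have : \forall t \near w, q.[t] < 0.
  exact: (cvgr_lt _ (@continuous_horner R q w) _ qw).
move=> /nbhs_ballP[e /= e0 he].
pose I : set R := `]w - e, w + e[%classic.
have sub : I `<=` N.
  move=> t; rewrite /I /= in_itv /= => /andP[t1 t2]; apply: sN => /=; apply/negP.
  rewrite -ltNge; apply: he; rewrite /ball /= ltr_norml.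
  by apply/andP; split; lra.
have : (lebesgue_measure I <= lebesgue_measure N)%E.
  by apply: le_measure => //; rewrite inE//; exact: measurable_itv.
rewrite N0 lebesgue_measure_itv /= lte_fin.
have -> : w - e < w + e by lra.
by rewrite -EFinB lee_fin; lra.
Qed.

Lemma Re_horner_real (f : {poly K}) :
  exists q : {poly R}, forall w : R, q.[w] = complex.Re f.[w%:C%C].
Proof.
exists (\poly_(k < size f) complex.Re f`_k) => w; rewrite horner_poly horner_coef.
rewrite (big_morph _ (@cReD R) (_ : complex.Re 0 = 0))//; apply: eq_bigr => k _.
by rewrite -rmorphXn /= cReM /= mulr0 subr0.
Qed.

Lemma conj_real (w : R) : ((w%:C%C : K))^* = w%:C%C.
Proof. by apply/eqP; rewrite eq_complex /= oppr0 !eqxx. Qed.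

Lemma imaginaryE (s : K) : s^* = - s -> s = (0 +i* complex.Im s)%C.
Proof.
move=> h; apply/eqP; rewrite eq_complex /= eqxx andbT.
by have := congr1 (@complex.Re R) h; case: s {h} => u v /= h; lra.
Qed.

Lemma addcc_ge0 (z : K) : (0 <= addcc z) = (0 <= complex.Re z).
Proof.
rewrite lecE /= /addcc; case: z => u v /=; rewrite addrN eqxx /=.
by apply/idP/idP; lra.
Qed.

(** Multiplying by the squared modulus of [g] keeps the sign and yields the real part of f times the
    conjugate of g, a real polynomial in [w]. *)
Lemma imaginary_axis_ge0 (f g : {poly K}) :
  {ae (@lebesgue_measure R), forall w : R,
    g.[(0 +i* w)%C] != 0 -> 0 <= complex.Re (f.[(0 +i* w)%C] / g.[(0 +i* w)%C])} ->
  forall w : R, g.[(0 +i* w)%C] != 0 ->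
    0 <= complex.Re (f.[(0 +i* w)%C] / g.[(0 +i* w)%C]).
Proof.
move=> ae.
have iw (w : R) : (0 +i* w)%C = 'i%C * w%:C%C.
  apply/eqP; rewrite eq_complex /=.
  by apply/andP; split; apply/eqP; ring.
pose fi := f \Po ('i%C *: 'X); pose gi := g \Po ('i%C *: 'X).
have fiE (w : R) : fi.[w%:C%C] = f.[(0 +i* w)%C].
  by rewrite horner_comp hornerZ hornerX iw.
have giE (w : R) : gi.[w%:C%C] = g.[(0 +i* w)%C].
  by rewrite horner_comp hornerZ hornerX iw.
have [q qE] := Re_horner_real (fi * map_poly (@Num.conj K) gi).
have {}qE w : q.[w] = complex.Re (f.[(0 +i* w)%C] * (g.[(0 +i* w)%C])^*).
  rewrite qE hornerM fiE -giE; congr (complex.Re (_ * _)).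
  by rewrite -{1}(conj_real w) horner_map.
have quot w : g.[(0 +i* w)%C] != 0 ->
    (0 <= complex.Re (f.[(0 +i* w)%C] / g.[(0 +i* w)%C])) = (0 <= q.[w]).
  move=> g0; rewrite -!addcc_ge0 qE -addcc_ge0; set u := f.[_]; set v := g.[_] in g0 *.
  have v0 : 0 < v * v^* by rewrite lt_neqAle mul_conjC_ge0 eq_sym mul_conjC_eq0 g0.
  rewrite -(pmulr_rge0 _ v0); congr (0 <= _); rewrite /addcc !rmorphM fmorphV /= conjCK.
  have vc0 : v^* != 0 by rewrite conjC_eq0.
  by field; apply/andP; split.
have q0 : forall w, 0 <= q.[w].
  apply: ae_poly_ge0.
  apply: (filterS _ ae); first exact: (ae_filter_ringOfSetsType (@lebesgue_measure R)).
  move=> w h.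
  (* At zeros of [g], about which the hypothesis is silent, the polynomial vanishes. *)
  have [g0|g0] := eqVneq g.[(0 +i* w)%C] 0; first by rewrite qE g0 rmorph0 mulr0.
  by rewrite -quot// h.
by move=> w g0; rewrite quot.
Qed.

Lemma ae_horner_neq0 (q : {poly K}) : q != 0 ->
  {ae (@lebesgue_measure R), forall w : R, q.[(0 +i* w)%C] != 0}.
Proof.
move=> q0; have [rs qE] := closed_field_poly_normal q.
pose Z := [set` [seq complex.Im r | r <- rs]].
have Zc : countable Z by apply: finite_set_countable; exact: finite_seq.
exists Z; split.
- by apply: countable_measurable.
- exact: countable_lebesgue_measure0.
- move=> w /= /negP/negPn; rewrite qE hornerZ mulf_eq0 lead_coef_eq0 (negPf q0) /=.
  by rewrite -/(root _ _) root_prod_XsubC => h; apply/mapP; exists (0 +i* w)%C.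
Qed.

Lemma open_right_half_plane : open (@right_half_plane R : set K^o).
Proof.
rewrite openE => s /= s0; apply/nbhs_ballP; exists ((complex.Re s)%:C%C).
  by rewrite /= ltcR.
move=> z; rewrite /ball /= => sz; rewrite /right_half_plane /=.
have := le_lt_trans (normc_ge_Re _) sz; rewrite ltcR.
by case: s z {sz} s0 => [a b] [c d] /= a0; rewrite ltr_norml => /andP[]; lra.
Qed.

End AlmostEverywhere.

(** * Positivity of transfer functions *)

Section Positivity.
Variables (R : realType) (n p : nat).
Local Notation K := R[i].
Variables (A : 'M[K]_n) (B : 'M[K]_(n, p)) (Cm : 'M[K]_(p, n)) (D : 'M[K]_p).
Local Notation F := (transfer (block_mx A B Cm D)).

Lemma psd_addTP (M : 'M[K]_p) :
  psd (M + M ^t* ) <-> forall x, 0 <= addcc (dotc x (M *m x)).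
Proof.
split=> [[_ h] x|h]; first by rewrite -qform_addT qformE.
by split=> [|x]; [exact: herm_addT|rewrite -qformE qform_addT].
Qed.

(** For fixed [w], w^* F w is a rational function, so its sign extends from almost all of the
    imaginary axis to every point off the spectrum of [A]. *)
Lemma gen_positive_fdi : gen_positive_fun R p F ->
  forall s (x : 'cV[K]_n) (w : 'cV[K]_p), s^* = - s -> (char_poly A).[s] != 0 ->
  s *: x = A *m x + B *m w -> 0 <= addcc (dotc w (Cm *m x + D *m w)).
Proof.
move=> gp s x w sN chi0 sx; rewrite (input_state _ _ chi0 sx).
pose f := \sum_i \sum_j ((w i ord0)^* * w j ord0)%:P * transfer_num A B Cm D i j.
have fE t : (char_poly A).[t] != 0 ->
    f.[t] / (char_poly A).[t] = dotc w (ratmx_eval F t *m w).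
  move=> t0; rewrite /f horner_sum mulr_suml dotcE; apply: eq_bigr => i _.
  rewrite [(ratmx_eval F t *m w) i ord0]mxE horner_sum mulr_suml mulr_sumr.
  apply: eq_bigr => j _.
  by rewrite ratmx_evalE// hornerM hornerC; ring.
move: chi0; rewrite (imaginaryE sN) => chi0.
rewrite addcc_ge0 -fE//; apply: imaginary_axis_ge0 => //.
apply: (filterS _ gp); first exact: (ae_filter_ringOfSetsType (@lebesgue_measure R)).
by move=> t /psd_addTP ht t0; rewrite fE// -addcc_ge0.
Qed.

(** For imaginary s the state term s x^* H x has zero real part, since x^* H x is real; only the
    supply remains. *)
Lemma lmi_gen_positive (H : 'M[K]_n) : H \is hermsymmx ->
  Lbar (diag2 H 1%:M) (block_mx A B Cm D) -> gen_positive_fun R p F.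
Proof.
move=> hH /(Lbar_blockP _ _ _ _ hH) lmi.
have chi0 : char_poly A != 0 by rewrite monic_neq0 ?char_poly_monic.
apply: (filterS _ (ae_horner_neq0 chi0)).
  exact: (ae_filter_ringOfSetsType (@lebesgue_measure R)).
move=> t t0; apply/psd_addTP => w; have [sx ->] := state_of_input B Cm D w t0.
set s := (0 +i* t)%C in t0 sx *; set x := invmx _ *m _ in sx *.
have := lmi x w; rewrite -sx -scalemxAr dotcZr addccD [X in X + _](_ : _ = 0) ?add0r//.
rewrite /addcc rmorphM /= herm_conj//.
have -> : s^* = - s by apply/eqP; rewrite eq_complex /= oppr0 !eqxx.
by rewrite mulNr addrN.
Qed.

(** With weight -1 the state term is -2 Re(s) |x|^2, so in the right half plane the supply dominates
    a nonnegative quantity. *)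
Lemma lmi_positive : Lbar (diag2 (- 1%:M) 1%:M) (block_mx A B Cm D) ->
  positive_fun R p F.
Proof.
have hN : (- 1%:M : 'M[K]_n) \is hermsymmx.
  by rewrite -scaleN1r herm_scale ?herm1// rpredN rpred1.
move=> /(Lbar_blockP _ _ _ _ hN) lmi.
have addsc (s : K) (x : 'cV[K]_n) :
    addcc (dotc x (- 1%:M *m (s *: x))) = - ((s + s^*) * dotc x x).
  by rewrite mulNmx mul1mx dotcNr dotcZr /addcc rmorphN rmorphM /= conj_dotc; ring.
have ss (s : K) : right_half_plane s -> 0 < s + s^*.
  rewrite /right_half_plane /= => s0; rewrite ltcE /=; case: s s0 => a b /= a0.
  by apply/andP; split; [apply/eqP|]; lra.
(* An eigenvector for such s, with zero input, would violate the inequality; hence no poles in the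
   right half plane. *)
have chi (s : K) : right_half_plane s -> (char_poly A).[s] != 0.
  move=> s0; rewrite horner_char_poly -det_tr; apply/negP => /det0P[v v0 vs].
  have sv : s *: v^T = A *m v^T.
    apply/eqP; rewrite -subr_eq0 -mul_scalar_mx -mulmxBl.
    by rewrite -[s%:M - A]trmxK -trmx_mul vs trmx0.
  have := lmi v^T 0; rewrite !mulmx0 !addr0 dotc0l addr0 -sv addsc oppr_ge0.
  rewrite pmulr_rle0 ?ss// => /(conj (dotc_ge0 v^T))/andP/le_anti/esym/eqP.
  by rewrite dotc_eq0 -trmx0 (inj_eq trmx_inj) (negPf v0).
split=> [|s s0].
  by apply: analytic_transfer => //; exact: open_right_half_plane.
apply/psd_addTP => w; have [sx ->] := state_of_input B Cm D w (chi s s0).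
set x := invmx _ *m _ in sx *.
have := lmi x w; rewrite -sx addccD addsc addrC subr_ge0; apply: le_trans.
by rewrite mulr_ge0 ?dotc_ge0// ltW ?ss.
Qed.

(** The inequality is available on the range of [Q]; passing to A Q, C Q and Q^* H Q extends it to
    all states and keeps the transfer function. *)
Lemma gen_positive_realization : gen_positive_fun R p F ->
  exists2 nu, (nu <= n)%N & exists2 L : 'M[K]_(n + p),
    Lbar (diag2 (Emx R nu n) 1%:M) L & F = transfer L.
Proof.
move=> /gen_positive_fdi/kyp_reachable[Q [H [hH QQ QA QB lmi]]].
have -> : F = transfer (block_mx (A *m Q) B (Cm *m Q) D).
  by apply: (@transfer_intertwine _ _ _ _ _ _ _ _ _ _ D Q); rewrite ?mulmxA ?QA ?QB.
apply: (@lmi_signature _ _ _ (Q ^t* *m H *m Q)); first exact: herm_mul.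
move=> x w; have := lmi (Q *m x) w; rewrite mulmxA QQ => /(_ erefl).
have -> : Cm *m Q *m x = Cm *m (Q *m x) by rewrite mulmxA.
set y := A *m Q *m x + B *m w.
have <- : Q *m y = A *m (Q *m x) + B *m w by rewrite /y mulmxDr !mulmxA QA QB.
suff -> : dotc x (Q ^t* *m H *m Q *m y) = dotc (Q *m x) (H *m (Q *m y)) by [].
by rewrite -(mulmxA _ Q) -(mulmxA _ H) [LHS]dotc_adj trmxCK.
Qed.

End Positivity.

(** * Change of signature and the three statements *)

Lemma Jmx_sqr (R : realType) nu l : Jmx R nu l *m Jmx R nu l = 1%:M.
Proof.
rewrite mulmx_diag -diag_const_mx; congr diag_mx; apply/rowP => i; rewrite !mxE.
by case: ifP => _; rewrite ?mulrNN mulr1.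
Qed.

Lemma NJmx (R : realType) nu l : - Jmx R nu l = Emx R nu l.
Proof.
rewrite /Jmx /Emx -raddfN; congr diag_mx; apply/rowP => i; rewrite !mxE.
by case: ifP => _; rewrite ?opprK.
Qed.

Lemma Emx_full (R : realType) l : Emx R l l = - 1%:M.
Proof.
rewrite -diag_const_mx -raddfN; congr diag_mx; apply/rowP => i; rewrite !mxE.
by rewrite ltn_ord.
Qed.

Lemma diag2_mul (R : realType) m n (A A' : 'M[R[i]]_m) (B B' : 'M[R[i]]_n) :
  diag2 A B *m diag2 A' B' = diag2 (A *m A') (B *m B').
Proof. by rewrite /diag2 mulmx_block !mulmx0 !mul0mx !addr0 add0r. Qed.

(** [J] is an involution exchanging the two weights, so the product of weight and system matrix,
    hence the inequality, is unchanged. *)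
Lemma Lbar_Jmx_bij (R : realType) nu l p :
  set_bij (Lbar (diag2 (Emx R nu l) (1%:M : 'M[R[i]]_p))) (Lbar (diag2 (- 1%:M) 1%:M))
    (fun L : 'M[R[i]]_(l + p) => diag2 (Jmx R nu l) 1%:M *m L).
Proof.
have hE k : diag2 (Emx R k l) (1%:M : 'M[R[i]]_p) \is hermsymmx.
  by rewrite diag2_herm ?herm1// Emx_herm.
have hN : diag2 (- 1%:M : 'M[R[i]]_l) (1%:M : 'M[R[i]]_p) \is hermsymmx.
  by rewrite -Emx_full.
pose J := diag2 (Jmx R nu l) (1%:M : 'M[R[i]]_p).
have J2 : J *m J = 1%:M.
  by rewrite /J diag2_mul Jmx_sqr mul1mx /diag2 -scalar_mx_block.
have JE : diag2 (- 1%:M) 1%:M *m J = diag2 (Emx R nu l) 1%:M.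
  by rewrite /J diag2_mul mulNmx !mul1mx NJmx.
have EJ : diag2 (Emx R nu l) 1%:M *m J = diag2 (- 1%:M) 1%:M.
  by rewrite -JE -mulmxA J2 mulmx1.
rewrite -/J; split.
- move=> L /(LbarP _ (hE nu)) hL; apply/(LbarP _ hN) => v.
  by rewrite -(mulmxA J) (mulmxA _ J) JE.
- move=> L L' _ _ /(congr1 (mulmx J)).
  by rewrite !mulmxA J2 !mul1mx.
- move=> L /(LbarP _ hN) hL; exists (J *m L); last by rewrite mulmxA J2 mul1mx.
  by apply/(LbarP _ (hE nu)) => v; rewrite -(mulmxA J) (mulmxA _ J) EJ.
Qed.

Theorem proposition7p6 (R : realType) (r p nu : nat) (hr : (2 <= r)%N)
    (hp1 : (1 <= p)%N) (hp2 : (p <= r - 1)%N) (hnu : (nu <= r - p)%N) :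
  (* (I) *)
  (r = (nu + p)%N -> (1 <= nu)%N -> GP R r nu p `<=` positive_fun R p) /\
  (* (II) *)
  (GP R r (r - p) p `<=` positive_fun R p /\
   set_bij (Lbar (diag2 (Emx R nu (r - p)) 1%:M))
           (Lbar (diag2 (- 1%:M) 1%:M))
           (fun L : sysmx R r p => diag2 (Jmx R nu (r - p)) 1%:M *m L) /\
   GP R r nu p =
     @transfer R (r - p) p @` Lbar (diag2 (Emx R nu (r - p)) 1%:M) /\
   GP R r (r - p) p =
     @transfer R (r - p) p @` Lbar (diag2 (- 1%:M) 1%:M)) /\
  (* (III) *)
  [set Psi | gen_positive_fun R p Psi /\
             exists L : sysmx R r p, Psi = transfer L] =
    \bigcup_(k in [set k | (k <= r - p)%N]) GP R r k p.
Proof.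
have GPE k : GP R r k p = @transfer R (r - p) p @` Lbar (diag2 (Emx R k (r - p)) 1%:M).
  by apply/seteqP; split=> F [L hL FL]; exists L.
have pos : GP R r (r - p) p `<=` positive_fun R p.
  move=> F [L hL ->]; move: hL; rewrite /sys_weight Emx_full -[L]submxK.
  exact: lmi_positive.
(* Here nu = r - p, so every state sign is negative and (I) reduces to [pos]. *)
split; first by move=> rE _; have -> : nu = (r - p)%N by rewrite rE addnK.
split.
  split; first exact: pos.
  split; first exact: Lbar_Jmx_bij.
  split; first exact: GPE.
  by rewrite -Emx_full; exact: GPE.
apply/seteqP; split=> [F [gp [L FL]]|F [k hk [L hL ->]]].
  move: gp; rewrite FL -[L]submxK => /gen_positive_realization[k kn [L' hL' ->]].
  by exists k => //; exists L'.
split; last by exists L.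
move: hL; rewrite -[L]submxK; apply: lmi_gen_positive.
exact: Emx_herm.
Qed.
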